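(* Let $A,B,C$ be real symmetric $m\times m$ matrices with $C>0$, let $Q(s)=A+2sB+s^2C$, and let $n,r$ be nonnegative integers. Then there exists a unipotent manifold $M$ with signature $(n,m,r,0)$ such that $Q$ is a characteristic polynomial of $M$ if and only if all of the following hold: (i) $Q(s)>0$ for all $s\in\mathbb{R}$; (ii) $m+r+2\le n$; (iii) $C-BA^{-1}B\ge 0$; (iv) $r=\operatorname{rank}(C-BA^{-1}B)$. Moreover, if $m=r$, then condition (i) may be replaced by the weaker condition $A>0$.
   Context: For a real matrix $S$, $S>0$ (resp. $S\ge0$) means that $S$ is symmetric positive definite (resp. symmetric nonnegative definite). Main construction. Let $V$ be a real vector space of dimension $n\ge 2$ with a symmetric bilinear form $\ell$ of signature $(+,-,\dots,-)$, and let $\mathcal C$ be one of the two closed convex cones whose union is $\{v:\ell(v,v)\ge0\}$. Let $v_0,v_1\in\partial \mathcal C$ satisfy $\ell(v_0,v_1)=1$ and put $L=\mathbb{R}v_0$, $W=L^\perp$, $N=W\cap v_1^\perp$, $l_0(v)=\ell(v_0,v)$ (orthogonal complements are with respect to $\ell$; $\ell$ is negative definite on $N$). Let $T\subseteq N$ be a linear subspace, $\Gamma$ a lattice (cocompact discrete subgroup) in $T$, and $a:T\to N$ a linear map with $\ell(ax,y)=\ell(x,ay)$ for $x,y\in T$ and $\ker(\mathbf 1+sa)=0$ for all $s\in\mathbb{R}$, where $(\mathbf 1+sa)x=x+s\,ax$. The vector group $T$ acts on $V$ by $\gamma_x(v)=\lambda(x)v+\tau(x)$, $x\in T$, where $$\lambda(x)v=v+l_0(v)ax-\Big(\ell(ax,v)+\tfrac12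 l_0(v)\ell(ax,ax)\Big)v_0,\qquad \tau(x)=x-\tfrac12\ell(ax,x)v_0.$$ Under these conditions $\Gamma$ acts on $V$ freely and properly by $x\mapsto\gamma_x$; the quotient $M=M(v_0,v_1,T,a,\Gamma)=V/\Gamma$ is a Lorentzian manifold with the metric induced by $\ell$ and the field of cones induced by $\mathcal C$. A unipotent manifold is a Lorentzian manifold (with cone field) that admits a realization $M(v_0,v_1,T,a,\Gamma)$. Signature. Write $a=a'+a''$ where $a':T\to T$ is determined by $\ell(a'x,y)=\ell(ax,y)$ for $x,y\in T$, and $a'':T\to T^\perp\cap N$. Put $R=a''T$. The signature of $M$ is $(n,m,r,k)$ with $n=\dim M$, $m=\dim T$, $r=\dim R$, $k=\dim\ker a$; it does not depend on the realization. Characteristic polynomial. Choose a realization of $M$ and a linear isomorphism $\iota:\mathbb{R}^m\to T$ with $\iota\,\mathbb{Z}^m=\Gamma$. For $x\in T$, $s\in\mathbb{R}$ put $q_s(x)=-\ell((\mathbf 1+sa)x,(\mathbf 1+sa)x)$. There are unique symmetric real $m\times m$ matrices $A,B,C$ such that $q_s(\iota z)=\langle (A+2sB+s^2C)z,z\rangle$ for all $z\in\mathbb{R}^m$, $s\in\mathbb{R}$, where $\langle\cdot,\cdot\rangle$ is the standard inner product. Then $A+2sB+s^2C$ is called a characteristic polynomial of $M$ (it depends on the realization and on $\iota$, and is considered up to orientation-preserving affine changes of $s$). *)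

(* Defs.v *)
From mathcomp Require Export all_boot all_order all_algebra.
From mathcomp Require Export sesquilinear.
From mathcomp Require Export all_classical all_reals all_analysis.
Export numFieldNormedType.Exports.

Set Implicit Arguments.
Unset Strict Implicit.
Unset Printing Implicit Defensive.
Import Order.TTheory GRing.Theory Num.Theory.
Local Open Scope classical_set_scope.
Local Open Scope ring_scope.

Section Matrices.
Context {R : realType} {m : nat}.

Definition posdefmx (S : 'M[R]_m) : Prop :=
  S \is symmetricmx /\ forall z : 'rV[R]_m, z != 0 -> 0 < (z *m S *m z^T) 0 0.

Definition nnegdefmx (S : 'M[R]_m) : Prop :=
  S \is symmetricmx /\ forall z : 'rV[R]_m, 0 <= (z *m S *m z^T) 0 0.

Definition qpolymx (A B C : 'M[R]_m) (s : R) : 'M[R]_m :=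
  A + (2 * s) *: B + s ^+ 2 *: C.

End Matrices.

Section Realizations.
Context {R : realType} {n : nat}.
Local Notation V := 'rV[R]_n.

Definition lorentzian (l : {symmetric V}) : Prop :=
  exists2 P : 'M[R]_n, P \in unitmx &
    forall i j : 'I_n, l (row i P) (row j P) =
      if i == j then (if (i == 0 :> nat)%N then 1 else -1) else 0.

Definition closed_convex_cone (K : set V) : Prop :=
  [/\ closed K, K 0, (forall u v, K u -> K v -> K (u + v)) &
      forall (t : R) u, 0 <= t -> K u -> K (t *: u)].

Definition causal_cone (l : {symmetric V}) (K : set V) : Prop :=
  closed_convex_cone K /\
  exists2 K', closed_convex_cone K' & K `|` K' = [set v | 0 <= l v v].

Definition boundary (K : set V) : set V := closure K `\` K°.

Definition Nspace (l : {symmetric V}) (v0 v1 : V) : {vspace V} :=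
  (orthov l <[v0]> :&: orthov l <[v1]>)%VS.

(* The last clause is the compactness of T / G. *)
Definition lattice (T : {vspace V}) (G : set V) : Prop :=
  [/\ G `<=` [set` T],
      G 0 /\ (forall x y, G x -> G y -> G (x - y)),
      G `<=` isolated G &
      exists K : set V, [/\ compact K, K `<=` [set` T] &
        forall x, x \in T -> exists2 y, G y & K (x - y)]].

End Realizations.

(* The ambient vector space is taken to be R^n, with an arbitrary form. *)
Record realization (R : realType) (n : nat) := Realization {
  rform : {symmetric 'rV[R]_n};
  rcone : set 'rV[R]_n;
  rv0 : 'rV[R]_n;
  rv1 : 'rV[R]_n;
  rT : {vspace 'rV[R]_n};
  ra : 'Hom(subvs_of rT, subvs_of (Nspace rform rv0 rv1));
  rGamma : set 'rV[R]_n;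
  _ : (2 <= n)%N;
  _ : lorentzian rform;
  _ : causal_cone rform rcone;
  _ : boundary rcone rv0;
  _ : boundary rcone rv1;
  _ : rform rv0 rv1 = 1;
  _ : (rT <= Nspace rform rv0 rv1)%VS;
  _ : lattice rT rGamma;
  _ : forall x y : subvs_of rT, rform (vsval (ra x)) (vsval y)
                                = rform (vsval x) (vsval (ra y));
  _ : forall (s : R) (x : subvs_of rT), vsval x + s *: vsval (ra x) = 0 -> x = 0 }.

Arguments ra {R n} r.

Section Quotients.
Context {R : realType} {n : nat}.
Local Notation V := 'rV[R]_n.
Implicit Types M rho : realization R n.

Definition action rho (x : subvs_of (rT rho)) (v : V) : V :=
  let l := rform rho in
  let l0 := l (rv0 rho) v in
  let ax := vsval (ra rho x) in
  let lambda := v + l0 *: ax - (l ax v + 2^-1 * l0 * l ax ax) *: rv0 rho in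
  let tau := vsval x - (2^-1 * l ax (vsval x)) *: rv0 rho in
  lambda + tau.

Definition orbit rho (v : V) : set V :=
  [set w | exists2 x : subvs_of (rT rho), rGamma rho (vsval x) & w = action x v].

Definition orbit_space rho : set (set V) := range (orbit rho).

Fixpoint Ck (k : nat) (U : set V) (h : V -> V) : Prop :=
  match k with
  | 0 => forall x, U x -> {for x, continuous h}
  | k'.+1 => (forall x, U x -> differentiable h x) /\
             forall v : V, Ck k' U ('D_v h)
  end.

Definition smooth (U : set V) (h : V -> V) : Prop := forall k, Ck k U h.

(* The orbit maps V -> V/Gamma are local isometries, so a map between orbit
   spaces is smooth and preserves the metric and the cone field iff its local
   lifts to V do. *)
Definition isometric M M' : Prop :=
  exists f : set V -> set V, set_bij (orbit_space M) (orbit_space M') f /\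
  forall v : V, exists (U : set V) (h : V -> V),
    [/\ open_nbhs v U, smooth U h,
        (forall u, U u -> f (orbit M u) = orbit M' (h u)) &
        forall u, U u ->
          (forall w w', rform M' ('d h u w) ('d h u w') = rform M w w') /\
          'd h u @` rcone M = rcone M'].

(* A unipotent manifold is given as the orbit space V/Gamma of one of its
   realizations; its realizations are all those with an isometric orbit
   space. *)
Definition unipotent_manifold := realization R n.

Definition realizes rho (M : unipotent_manifold) : Prop := isometric M rho.

Definition realization_signature rho (sigma : nat * nat * nat * nat) : Prop :=
  exists (a' : 'Hom(subvs_of (rT rho), subvs_of (rT rho)))
         (a'' : 'Hom(subvs_of (rT rho),
                     subvs_of (Nspace (rform rho) (rv0 rho) (rv1 rho)))),
  [/\ forall x, vsval (ra rho x) = vsval (a' x) + vsval (a'' x),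
      forall x y : subvs_of (rT rho), rform rho (vsval (a' x)) (vsval y)
                  = rform rho (vsval (ra rho x)) (vsval y) &
      sigma = (n, \dim (rT rho), \dim (limg a''), \dim (lker (ra rho)))].

Definition signature (M : unipotent_manifold) (sigma : nat * nat * nat * nat) : Prop :=
  exists2 rho, realizes rho M & realization_signature rho sigma.

Definition qform rho (s : R) (x : subvs_of (rT rho)) : R :=
  let y := vsval x + s *: vsval (ra rho x) in - rform rho y y.

Definition characteristic_polynomial (m : nat) (M : unipotent_manifold)
    (Q : R -> 'M[R]_m) : Prop :=
  exists (rho : realization R n) (iota : 'Hom('rV[R]_m, subvs_of (rT rho)))
         (A B C : 'M[R]_m) (alpha beta : R),
  [/\ realizes rho M,
      bijective iota /\
      [set vsval (iota (map_mx intr z)) | z in [set: 'rV[int]_m]] = rGamma rho,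
      [/\ A \is symmetricmx, B \is symmetricmx & C \is symmetricmx],
      forall (s : R) (z : 'rV[R]_m),
        qform s (iota z) = (z *m qpolymx A B C s *m z^T) 0 0 &
      0 < alpha /\ forall s, Q s = qpolymx A B C (alpha * s + beta)].

End Quotients.

Arguments unipotent_manifold : clear implicits.

(* Main.v *)
(** An isometry between two quotients [V/Gamma] lifts locally to affine maps,
    because the second derivative of a smooth local isometry between constant
    nondegenerate metrics vanishes, and a single affine map works on all of
    [V], because [Gamma'] acts properly.  Its linear part maps the span of the
    displacements [gamma_x v - v] onto the corresponding span of the other
    realization.  For [a <> 0] this span is [R v0 + T + aT], of dimension
    [1 + m + r]; so all realizations of a manifold have the same [r].

    In a realization [Q s] is minus the Gram matrix of [1 + sa], taken on a
    basis of [T], and [C - B A^-1 B] is minus the Gram matrix of the component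
    of [aT] orthogonal to [T]; an affine change of [s] amounts to replacing [T]
    by [(1 + beta a) T] and [a] by a multiple.  Since the form is negative
    definite on [N], the rank of [C - B A^-1 B] is [dim (T + aT) - m].

    Conversely, write [A = P P^T] and [C - B A^-1 B = S S^T], where [S] has [r]
    columns; let [T] be spanned by the rows of [[P 0]] and let [a] map them to
    the rows of [[B P^-T S]].  If [m = r], then
    [Q s = (A + s B) A^-1 (A + s B) + s^2 (C - B A^-1 B)] is positive. *)

Require Import Defs.
From HB Require Import structures.
From mathcomp Require Import zify ring lra.
Import Order.TTheory GRing.Theory Num.Theory.
Set Implicit Arguments.
Unset Strict Implicit.
Unset Printing Implicit Defensive.
Local Open Scope classical_set_scope.
Local Open Scope ring_scope.

(** * Gram matrices *)

Section SymmetricMatrices.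
Variable R : realType.

Lemma symmetricmxP (m : nat) (S : 'M[R]_m) :
  reflect (S^T = S) (S \is symmetricmx).
Proof.
apply: (iffP (is_hermitianmxP _ _ _)); rewrite expr0 scale1r map_mx_id//.
Qed.

Lemma mulmx_tr_ge0 (p : nat) (z : 'rV[R]_p) : 0 <= (z *m z^T) 0 0.
Proof. by rewrite mxE sumr_ge0// => i _; rewrite mxE -expr2 sqr_ge0. Qed.

Lemma mulmx_tr_eq0 (p : nat) (z : 'rV[R]_p) : (z *m z^T) 0 0 = 0 -> z = 0.
Proof.
rewrite mxE => /eqP; rewrite psumr_eq0 => [/allP z0|i _]; last first.
  by rewrite mxE -expr2 sqr_ge0.
apply/rowP => i; have := z0 i; rewrite mem_index_enum => /(_ isT).
by rewrite /= !mxE -expr2 sqrf_eq0 => /eqP.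
Qed.

Lemma qform_gram (m p : nat) (F : 'M[R]_(m, p)) (z : 'rV[R]_m) :
  (z *m (F *m F^T) *m z^T) 0 0 = ((z *m F) *m (z *m F)^T) 0 0.
Proof. by rewrite trmx_mul !mulmxA. Qed.

(** If [z *m F *m F^T] vanishes, so does the sum of squares of the entries of [z *m F]; hence the
    left kernel of the Gram matrix is no larger than that of [F]. *)
Lemma rank_gram (m p : nat) (F : 'M[R]_(m, p)) : \rank (F *m F^T) = \rank F.
Proof.
apply/eqP; rewrite eqn_leq mxrankM_maxl /=.
have : (kermx (F *m F^T) <= kermx F)%MS.
  apply/row_subP => i; set z := row i _.
  have : z *m (F *m F^T) = 0 by apply/sub_kermxP; exact: row_sub.
  move=> z0; apply/sub_kermxP/mulmx_tr_eq0.
  by rewrite -qform_gram z0 mul0mx mxE.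
move/mxrankS; rewrite !mxrank_ker.
have := rank_leq_row F; have := rank_leq_row (F *m F^T).
by move: (\rank F) (\rank _) => a b; lia.
Qed.

Lemma gram_nneg (m p : nat) (F : 'M[R]_(m, p)) : nnegdefmx (F *m F^T).
Proof.
split; first by apply/symmetricmxP; rewrite trmx_mul trmxK.
by move=> z; rewrite qform_gram mulmx_tr_ge0.
Qed.

(** Cholesky factorization by induction on the size: the first row is split off, and the induction
    hypothesis is applied to the Schur complement of the corner entry [d]. When [d = 0],
    nonnegativity forces the rest of the first row to vanish. *)
Lemma nnegdef_factor (m : nat) (S : 'M[R]_m) : nnegdefmx S ->
  exists P : 'M[R]_m, S = P *m P^T.
Proof.
elim: m S => [S _|m IH]; first by exists 0; apply/matrixP => -[].
rewrite -[m.+1]/(1 + m)%N => S [/symmetricmxP Ssym S0].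
pose d := S 0 0; pose b := ursubmx S; pose D := drsubmx S.
have SE : S = block_mx d%:M b b^T D.
  rewrite -{1}[S]submxK; congr block_mx.
    by rewrite [LHS]mx11_scalar; congr (_%:M); rewrite !mxE; congr (S _ _); exact/val_inj.
  by rewrite -[in LHS]Ssym trmx_ursub.
have Dsym : D^T = D by rewrite /D trmx_drsub Ssym.
have q x (y : 'rV[R]_m) : 0 <= d * x ^+ 2 + 2 * x * (b *m y^T) 0 0 + (y *m D *m y^T) 0 0.
  have := S0 (row_mx x%:M y); rewrite SE mul_row_block tr_row_mx mul_row_col.
  rewrite !mulmxDl tr_scalar_mx !mul_scalar_mx !mul_mx_scalar -!scalemxAl.
  rewrite !mxE.
  have -> : \sum_j y 0 j * b^T j 0 = \sum_j b 0 j * y^T j 0.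
    by apply: eq_bigr => j _; rewrite !mxE mulrC.
  by rewrite eqxx mulr1n => h; apply: le_trans h _; rewrite le_eqVlt;
    apply/orP; left; apply/eqP; ring.
have d0 : 0 <= d by have := q 1 0; rewrite trmx0 !mulmx0 !mxE; lra.
have [dz|dn] := eqVneq d 0.
  have bb0 : b = 0.
    apply: mulmx_tr_eq0; apply/eqP; rewrite eq_le mulmx_tr_ge0 andbT leNgt.
    apply/negP => bb; set c := (b *m D *m b^T) 0 0.
    (* With [d = 0] the form is affine in [x]; this [x] brings its value down to [-1]. *)
    have := q (- (c + 1) / (2 * (b *m b^T) 0 0)) b.
    rewrite dz mul0r add0r -/c.
    have -> : 2 * (- (c + 1) / (2 * (b *m b^T) 0 0)) * (b *m b^T) 0 0 = - (c + 1).
      by field; rewrite gt_eqF.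
    by lra.
  have [|P DP] := IH D.
    split; first exact/symmetricmxP.
    by move=> y; have := q 0 y; rewrite dz; lra.
  exists (block_mx 0 0 0 P); rewrite SE bb0 dz tr_block_mx mulmx_block DP.
  by rewrite !trmx0 !(mulmx0, mul0mx) !add0r -scalemx1 scale0r.
have dp : 0 < d by rewrite lt_def dn.
pose e := Num.sqrt d; have e2 : e ^+ 2 = d by rewrite sqr_sqrtr.
have e0 : e != 0 by rewrite sqrtr_eq0 -ltNge.
have [|P DP] := IH (D - d^-1 *: (b^T *m b)).
  split.
    by apply/symmetricmxP; rewrite linearB /= linearZ /= trmx_mul trmxK Dsym.
  (* This [x] minimizes the form over the first coordinate, and the minimum is the Schur complement
     evaluated at [y]. *)
  move=> y; have := q (- (b *m y^T) 0 0 / d) y.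
  rewrite mulmxBr mulmxBl -scalemxAr -scalemxAl mulmxA -[_ *m b *m _]mulmxA.
  have -> : y *m b^T = (b *m y^T)^T by rewrite trmx_mul trmxK.
  rewrite [(b *m y^T)]mx11_scalar tr_scalar_mx -scalar_mxM !mxE eqxx mulr1n.
  set t := (\sum_(_ < _) _); set u := (\sum_(_ < _) _).
  suff -> : d * (- t / d) ^+ 2 + 2 * (- t / d) * t + u = u - d^-1 * (t * t) by [].
  by field.
exists (block_mx e%:M 0 (e^-1 *: b^T) P).
rewrite SE tr_block_mx mulmx_block !trmx0 !(mulmx0, mul0mx) !addr0 -DP.
rewrite tr_scalar_mx -scalar_mxM -expr2 e2 linearZ /= trmxK.
rewrite mul_scalar_mx scalerA divff// scale1r mul_mx_scalar scalerA divff// scale1r.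
rewrite -scalemxAl -scalemxAr scalerA -expr2 exprVn e2.
by rewrite addrC subrK.
Qed.

(** In [P = col_base P *m row_base P] the Gram matrix of [row_base P] has size [\rank P]; factoring
    it again leaves a factor with only that many columns. *)
Lemma nnegdef_factor_rank (m r : nat) (S : 'M[R]_m) : nnegdefmx S ->
  r = \rank S -> exists F : 'M[R]_(m, r), S = F *m F^T.
Proof.
move=> /nnegdef_factor[P ->]; rewrite rank_gram => ->.
have [K KE] := nnegdef_factor (gram_nneg (row_base P)).
exists (col_base P *m K).
rewrite trmx_mul mulmxA -[_ *m K *m _]mulmxA -KE mulmxA mulmx_base.
by rewrite -mulmxA -trmx_mul mulmx_base.
Qed.

Lemma posdef_nneg (m : nat) (S : 'M[R]_m) : posdefmx S -> nnegdefmx S.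
Proof.
move=> [Ss S0]; split=> // z; have [->|z0] := eqVneq z 0; last exact/ltW/S0.
by rewrite !mul0mx mxE.
Qed.

Lemma posdef_unit (m : nat) (S : 'M[R]_m) : posdefmx S -> S \in unitmx.
Proof.
move=> [_ S0]; rewrite -row_free_unit -kermx_eq0.
apply/eqP/row_matrixP => i; rewrite row0; set z := row i _; apply/eqP.
apply: contraT => /S0.
have -> : z *m S = 0 by apply/sub_kermxP; exact: row_sub.
by rewrite mul0mx mxE ltxx.
Qed.

Lemma nneg_unit_posdef (m : nat) (S : 'M[R]_m) :
  nnegdefmx S -> S \in unitmx -> posdefmx S.
Proof.
move=> nS; have [P SP] := nnegdef_factor nS; have [Ss _] := nS => Su; split=> // z z0.
rewrite SP qform_gram lt_def mulmx_tr_ge0 andbT; apply: contra z0 => /eqP/mulmx_tr_eq0 zP.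
apply/eqP/(can_inj (mulmxK Su)); rewrite mul0mx SP mulmxA zP mul0mx.
by [].
Qed.

Lemma posdef_factor (m : nat) (S : 'M[R]_m) : posdefmx S ->
  exists2 P : 'M[R]_m, P \in unitmx & S = P *m P^T.
Proof.
move=> pS; have [P SP] := nnegdef_factor (posdef_nneg pS); exists P => //.
by have := posdef_unit pS; rewrite SP unitmx_mul => /andP[].
Qed.

Lemma invmx_gram (m : nat) (P : 'M[R]_m) : P \in unitmx ->
  invmx (P *m P^T) = invmx P^T *m invmx P.
Proof.
move=> Pu; have PTu : P^T \in unitmx by rewrite unitmx_tr.
apply: (can_inj (mulmxK (_ : P *m P^T \in unitmx))); first by rewrite unitmx_mul Pu.
rewrite mulVmx ?unitmx_mul ?Pu// -mulmxA [invmx P *m _]mulmxA mulVmx// mul1mx.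
by rewrite mulVmx.
Qed.

End SymmetricMatrices.

(** * Local isometries *)

Lemma mvt0 (R : realType) (f df : R -> R) (t : R) : 0 < t ->
  (forall a, 0 <= a <= t -> is_derive a 1 f (df a)) ->
  exists2 c, 0 < c < t & f t - f 0 = t * df c.
Proof.
move=> t0 fd; have [x|c|c] := @MVT R f df 0 t t0.
- by rewrite in_itv/= => /andP[x0 xt]; apply: fd; rewrite !ltW.
- apply: derivable_within_continuous => x; rewrite in_itv/= => xt.
  by have := fd x xt; case.
- by rewrite in_itv/= subr0 mulrC => ? ?; exists c.
Qed.

Lemma is_derive_line (R : realType) (V : normedModType R) (g : V -> R)
    (q v : V) (a : R) (dg : R) : is_derive (q + a *: v) v g dg ->
  is_derive a 1 (fun t : R => g (q + t *: v)) dg.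
Proof.
have E : (fun h : R => h^-1 *: (g (h *: v + (q + a *: v)) - g (q + a *: v))) =
   (fun h : R => h^-1 *: (g (q + (h *: 1 + a) *: v) - g (q + a *: v))).
  apply/funext => h; congr (_ *: (g _ - _)).
  by rewrite scalerDl addrCA /GRing.scale/= mulr1.
by case; rewrite /derivable /derive E => cv lv; split.
Qed.

(** The mean value theorem is applied along [v] to the increment of [g] over [t *: w], then along
    [w] to [g']. The second difference is thus [t ^+ 2] times a value of [g''] near [p], and [g'']
    is continuous at [p]. *)
Lemma second_difference (R : realType) (V : normedModType R) (g g' g'' : V -> R)
    (U : set V) (p v w : V) : open_nbhs p U ->
  (forall u, U u -> is_derive u v g (g' u)) ->
  (forall u, U u -> is_derive u w g' (g'' u)) ->
  {for p, continuous g''} ->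
  forall e : R, 0 < e -> exists2 d, 0 < d & forall t, 0 < t < d ->
    `|(g (p + t *: w + t *: v) - g (p + t *: v)) - (g (p + t *: w) - g p)
      - t ^+ 2 * g'' p| <= e * t ^+ 2.
Proof.
move=> Up dg ddg cont e e0.
have Un : nbhs p U by apply: open_nbhs_nbhs.
have Cn : nbhs p [set u | `|g'' p - g'' u| < e].
  by move/cvgrPdist_lt : cont; apply.
have [r /= r0 rU] := (nbhs_ballP _ _).1 (filterI Un Cn).
have N0 : 0 < `|v| + `|w| + 1 by rewrite ltr_wpDl// addr_ge0.
(* This bound on [t] keeps the whole parallelogram spanned at [p] by [t *: v] and [t *: w] within
   [r] of [p]; the summand 1 covers [v = w = 0]. *)
exists (r / (`|v| + `|w| + 1)); first by rewrite divr_gt0.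
move=> t /andP[t0 td].
have inU (a b : R) : 0 <= a <= t -> 0 <= b <= t ->
    U (p + b *: w + a *: v) /\ `|g'' p - g'' (p + b *: w + a *: v)| < e.
  move=> /andP[a0 at_] /andP[b0 bt]; apply: rU.
  rewrite -ball_normE /= -addrA opprD addrA subrr add0r normrN.
  apply: le_lt_trans (ler_normD _ _) _; rewrite !normrZ !ger0_norm//.
  rewrite ltr_pdivlMr// in td; apply: le_lt_trans td.
  rewrite !mulrDr mulr1 [t * _ + _]addrC.
  by rewrite ler_wpDr ?(ltW t0)// lerD ?ler_wpM2r.
have r0t : 0 <= (0:R) <= t by rewrite lexx ltW.
have rtt : 0 <= t <= t by rewrite lexx ltW.
pose f a := g (p + t *: w + a *: v) - g (p + a *: v).
have [a a0t|c /andP[c0 ct]] := @mvt0 R f (fun a => g' (p + t *: w + a *: v)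
    - g' (p + a *: v)) t t0.
  have [U1 _] := inU a t a0t rtt; have [U2 _] := inU a 0 a0t r0t.
  rewrite scale0r addr0 in U2.
  by apply: is_deriveB; apply: is_derive_line; apply: dg.
rewrite /f scale0r !addr0 => ->.
have ctt : 0 <= c <= t by rewrite !ltW.
have [b bt|d /andP[d0 dt]] := @mvt0 R (fun b => g' ((p + c *: v) + b *: w))
    (fun b => g'' ((p + c *: v) + b *: w)) t t0.
  apply: is_derive_line; apply: ddg; rewrite addrAC.
  by have [] := inU c b ctt bt.
rewrite scale0r addr0 addrAC => ->.
have [|_] := inU c d ctt; first by rewrite !ltW.
rewrite distrC => lt_e.
rewrite mulrA -expr2 -mulrBr normrM ger0_norm ?exprn_ge0 ?ltW// mulrC.
by rewrite ltr_pM2r ?exprn_gt0// addrAC.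
Qed.

(** Schwarz's theorem: the second difference does not change when [v] and [w] are exchanged, and
    divided by [t ^+ 2] it approximates both mixed derivatives. *)
Lemma derive_comm (R : realType) (V : normedModType R)
    (g gv gw gvw gwv : V -> R) (U : set V) (p v w : V) : open_nbhs p U ->
  (forall u, U u -> is_derive u v g (gv u)) ->
  (forall u, U u -> is_derive u w g (gw u)) ->
  (forall u, U u -> is_derive u w gv (gvw u)) ->
  (forall u, U u -> is_derive u v gw (gwv u)) ->
  {for p, continuous gvw} -> {for p, continuous gwv} ->
  gvw p = gwv p.
Proof.
move=> Up dv dw dvw dwv cvw cwv.
apply/eqP; rewrite -subr_eq0 -normr_eq0 eq_le normr_ge0 andbT.
apply/ler_addgt0Pr => /= e e0; rewrite add0r.
have e20 : 0 < e / 2 by rewrite divr_gt0.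
have [d1 d10 H1] := second_difference Up dv dvw cvw e20.
have [d2 d20 H2] := second_difference Up dw dwv cwv e20.
pose t := Num.min d1 d2 / 2.
have m0 : 0 < Num.min d1 d2 by rewrite lt_min d10.
have t0 : 0 < t by rewrite divr_gt0.
have tm : t < Num.min d1 d2 by rewrite /t ltr_pdivrMr// ltr_pMr// ltr1n.
have {H1} := H1 t; have {H2} := H2 t.
move: tm; rewrite lt_min => /andP[-> ->]; rewrite t0 => /(_ isT) H2 /(_ isT) H1.
have t20 : 0 < t ^+ 2 by rewrite exprn_gt0.
rewrite -(ler_pM2r t20) -[X in _ * X <= _]gtr0_norm// -normrM mulrBl.
rewrite (le_trans _ (_ : e / 2 * t ^+ 2 + e / 2 * t ^+ 2 <= _))//; last first.
  by rewrite -mulrDl -splitr.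
apply: le_trans (lerD H2 H1); apply: le_trans (ler_normB _ _).
rewrite [p + t *: w + t *: v]addrAC le_eqVlt; apply/orP; left; apply/eqP.
by congr (`|_|); ring.
Qed.

Lemma is_derive_coord (R : realType) (V : normedModType R) (m n : nat)
    (h : V -> 'M[R]_(m, n)) (u v : V) (dh : 'M[R]_(m, n)) i j :
  is_derive u v h dh -> is_derive u v (fun x => h x i j) (dh i j).
Proof.
case=> dr <-; split; first exact: (derivable_mxP h u v).1.
by rewrite derive_mx// mxE.
Qed.

(** * Symmetric forms and their derivatives *)

Lemma symC (R : realType) (n : nat) (l : {symmetric 'rV[R]_n}) x y :
  l x y = l y x.
Proof. by rewrite hermC /= expr0 mul1r. Qed.

Section SymmetricForm.
Variables (R : realType) (n : nat) (l : {symmetric 'rV[R]_n}).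
Implicit Types (x y z : 'rV[R]_n).

Lemma symZl a x y : l (a *: x) y = a * l x y.
Proof. by rewrite linearZl_LR. Qed.

Lemma symZr a x y : l x (a *: y) = a * l x y.
Proof. by rewrite linearZr_LR. Qed.

Lemma symDl x y z : l (x + y) z = l x z + l y z.
Proof. exact: linearDl. Qed.

Lemma symDr x y z : l x (y + z) = l x y + l x z.
Proof. exact: linearDr. Qed.

Lemma symNl x y : l (- x) y = - l x y.
Proof. exact: linearNl. Qed.

Lemma symNr x y : l x (- y) = - l x y.
Proof. exact: linearNr. Qed.

Lemma sym0l x : l 0 x = 0.
Proof. exact: linear0l. Qed.

Lemma sym0r x : l x 0 = 0.
Proof. exact: linear0r. Qed.

Lemma sym_suml I (r : seq I) (P : pred I) (F : I -> 'rV[R]_n) y :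
  l (\sum_(i <- r | P i) F i) y = \sum_(i <- r | P i) l (F i) y.
Proof. exact: linear_sumlz. Qed.

Lemma sym_sumr I (r : seq I) (P : pred I) (F : I -> 'rV[R]_n) x :
  l x (\sum_(i <- r | P i) F i) = \sum_(i <- r | P i) l x (F i).
Proof. exact: linear_sumr. Qed.

End SymmetricForm.

Definition symE := (symDl, symDr, symNl, symNr, symZl, symZr).

Lemma form_coord (R : realType) (n : nat) (l : {symmetric 'rV[R]_n}) x y :
  l x y = \sum_(i < n) \sum_(j < n) x 0 i * y 0 j * l 'e_i 'e_j.
Proof.
rewrite {1}[x]row_sum_delta linear_sumlz; apply: eq_bigr => i _.
rewrite linearZl_LR {1}[y]row_sum_delta linear_sumr mulr_sumr.
by apply: eq_bigr => j _; rewrite linearZr_LR /= mulrA.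
Qed.

Lemma is_derive_form (R : realType) (n : nat) (l : {symmetric 'rV[R]_n})
    (V : normedModType R) (f g : V -> 'rV[R]_n) (u v : V) (df dg : 'rV[R]_n) :
  is_derive u v f df -> is_derive u v g dg ->
  is_derive u v (fun x => l (f x) (g x)) (l df (g u) + l (f u) dg).
Proof.
move=> Hf Hg.
have -> : (fun x => l (f x) (g x)) = \sum_(i < n) \sum_(j < n)
    (fun x => f x 0 i * g x 0 j * l 'e_i 'e_j).
  apply/funext => x; rewrite form_coord fct_sumE; apply: eq_bigr => i _.
  by rewrite fct_sumE.
apply: is_derive_eq.
  apply: is_derive_sum => i; apply: is_derive_sum => j.
  apply: is_deriveM; apply: is_deriveM; exact: is_derive_coord.
rewrite !form_coord -big_split; apply: eq_bigr => i _.
rewrite -big_split; apply: eq_bigr => j _ /=.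
by rewrite /GRing.scale/=; ring.
Qed.

Section LocalIsometry.
Variables (R : realType) (n : nat) (l l' : {symmetric 'rV[R]_n}).
Local Notation V := 'rV[R]_n.
Hypothesis l_nondeg : forall x : V, (forall y, l x y = 0) -> x = 0.
Hypothesis l'_nondeg : forall x : V, (forall y, l' x y = 0) -> x = 0.
Variables (U : set V) (h : V -> V).
Hypotheses (openU : open U) (smoothh : smooth U h).
Hypothesis isoh : forall u, U u -> forall w w',
  l' ('d h u w) ('d h u w') = l w w'.

Let dh u v : U u -> is_derive u v h ('D_v h u).
Proof.
by move=> Uu; have [/(_ u Uu)/diff_derivable/derivableP + _] := smoothh 1.
Qed.

Let ddh u v w : U u -> is_derive u w ('D_v h) ('D_w ('D_v h) u).
Proof.
move=> Uu; have [_ /(_ v)[/(_ u Uu)/diff_derivable/derivableP + _]] := smoothh 2.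
exact.
Qed.

Let cddh u v w : U u -> {for u, continuous ('D_w ('D_v h))}.
Proof. by move=> Uu; have [_ /(_ v)[_ /(_ w)]] := smoothh 2; apply. Qed.

Let dd_comm u v w : U u -> 'D_w ('D_v h) u = 'D_v ('D_w h) u.
Proof.
move=> Uu; apply/rowP => i.
apply: (@derive_comm R V (fun x => h x 0 i) (fun x => 'D_v h x 0 i)
  (fun x => 'D_w h x 0 i) (fun x => 'D_w ('D_v h) x 0 i)
  (fun x => 'D_v ('D_w h) x 0 i) U u v w) => //.
- by move=> x Ux; apply: is_derive_coord; apply: dh.
- by move=> x Ux; apply: is_derive_coord; apply: dh.
- by move=> x Ux; apply: is_derive_coord; apply: ddh.
- by move=> x Ux; apply: is_derive_coord; apply: ddh.
- by apply: (@continuous_comp _ _ _ ('D_w ('D_v h)) (fun y : V => y 0 i));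
    [exact: cddh|exact: coord_continuous].
- by apply: (@continuous_comp _ _ _ ('D_v ('D_w h)) (fun y : V => y 0 i));
    [exact: cddh|exact: coord_continuous].
Qed.

Let dE u v : U u -> 'd h u v = 'D_v h u.
Proof.
by move=> Uu; have [/(_ u Uu) + _] := smoothh 1 => du; rewrite deriveE.
Qed.

(** The differential is injective since it carries a nondegenerate form to another form, and an
    injective endomorphism in finite dimension is onto. *)
Let dh_onto u y : U u -> exists w, 'D_w h u = y.
Proof.
move=> Uu; pose f := linfun ('d h u : V -> V).
have f0 : lker f == 0%VS.
  apply/lker0P => x z; rewrite !lfunE/= => xz; apply/eqP; rewrite -subr_eq0.
  apply/eqP/l_nondeg => w; rewrite linearBl/= -!(isoh Uu) xz subrr.
  by [].
exists ((f^-1)%VF y); rewrite -dE//.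
by have := lker0_lfunVK f0 y; rewrite lfunE.
Qed.

(* The trilinear form [l' (D_v D_w h) (D_z h)] is symmetric in [v, w] and
   skew in [w, z], hence zero. *)
Lemma local_isometry_dd u v w : U u -> 'D_w ('D_v h) u = 0.
Proof.
move=> Uu; pose B a b c := l' ('D_a ('D_b h) u) ('D_c h u).
have skew a b c : B a b c = - B a c b.
  apply/eqP; rewrite -addr_eq0 /B [X in _ + X]symC.
  have [_ E1] := is_derive_form l' (ddh b a Uu) (ddh c a Uu).
  (* On [U] the product of ['D_b h] and ['D_c h] is the constant [l b c]; its derivative along [a]
     is the sum of the two terms. *)
  have -> : 0 = 'D_a (cst (l b c) : V -> R) u by rewrite derive_cst.
  rewrite -E1; apply/eqP; apply: near_eq_derive.
  by apply: filterS (open_nbhs_nbhs (conj openU Uu)) => x Ux; rewrite -!dE// isoh.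
have sym a b c : B a b c = B b a c by rewrite /B dd_comm.
have B0 a b c : B a b c = 0.
  (* Exchanging alternately the last two and the first two arguments comes back to [a b c] after six
     moves, three of which change the sign. *)
  have : B a b c = - B a b c.
    by rewrite {1}skew sym skew sym skew sym !opprK.
  by move/eqP; rewrite -addr_eq0 -mulr2n mulrn_eq0 => /eqP.
apply: l'_nondeg => y; have [c <-] := dh_onto y Uu; exact: B0.
Qed.

End LocalIsometry.

(** In each coordinate, the mean value theorem on the segment from [p] to [u] produces ['D_v h] at
    an intermediate point, and a second application shows that this derivative equals the one at
    [p]. The segment stays in the ball. *)
Lemma dd0_affine (R : realType) (n : nat) (U : set 'rV[R]_n)
    (h : 'rV[R]_n -> 'rV[R]_n) (p : 'rV[R]_n) (r : R) :
  ball p r `<=` U -> smooth U h ->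
  (forall u v w, U u -> 'D_w ('D_v h) u = 0) ->
  forall u, ball p r u -> h u = h p + 'd h p (u - p).
Proof.
move=> pU smoothh dd0 u pu; pose v := u - p.
have r0 : 0 < r.
  by have := pu; rewrite -ball_normE /=; apply: le_lt_trans.
have Up : U p by apply/pU/ballxx.
have inU a : 0 <= a <= 1 -> U (p + a *: v).
  move=> /andP[a0 a1]; apply: pU; rewrite -ball_normE /= opprD addrA subrr.
  rewrite add0r normrN normrZ ger0_norm//.
  move: pu; rewrite -ball_normE /= distrC -/v.
  by apply: le_lt_trans; rewrite -[leRHS]mul1r ler_wpM2r.
have dh a : 0 <= a <= 1 -> is_derive (p + a *: v) v h ('D_v h (p + a *: v)).
  by move=> /inU Ua; have [/(_ _ Ua)/diff_derivable/derivableP + _] := smoothh 1.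
have ddh a : 0 <= a <= 1 -> is_derive (p + a *: v) v ('D_v h) 0.
  move=> /inU Ua; rewrite -(dd0 _ v v Ua).
  by have [_ /(_ v)[/(_ _ Ua)/diff_derivable/derivableP + _]] := smoothh 2.
apply/rowP => i; rewrite !mxE -/v.
have [a a01|c /andP[c0 c1]] := @mvt0 R (fun a => h (p + a *: v) 0 i)
    (fun a => 'D_v h (p + a *: v) 0 i) 1 ltr01.
  apply: (@is_derive_line _ _ (fun x => h x 0 i)).
  by apply: is_derive_coord; exact: dh.
rewrite mul1r scale1r scale0r addr0 [p + v]addrC subrK => /eqP.
rewrite subr_eq addrC => /eqP ->; congr (_ + _).
have [a /andP[a0 ac]|d _] := @mvt0 R (fun a => 'D_v h (p + a *: v) 0 i)
    (fun a => 0) c c0.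
  apply: (@is_derive_line _ _ (fun x => 'D_v h x 0 i)).
  have <- : (0 : 'rV[R]_n) 0 i = 0 by rewrite mxE.
  by apply: is_derive_coord; apply: ddh; rewrite a0 (le_trans ac)// ltW.
rewrite mulr0 scale0r addr0 => /eqP; rewrite subr_eq0 => /eqP ->.
by have [/(_ _ Up) + _] := smoothh 1 => du; rewrite deriveE.
Qed.

(** * Realizations *)

Section LorentzianForm.
Variables (R : realType) (n : nat) (l : {symmetric 'rV[R]_n}).
Local Notation V := 'rV[R]_n.
Hypotheses (n_ge2 : (2 <= n)%N) (lor : lorentzian l).

Let n_gt0 : (0 < n)%N. Proof. exact: ltnW. Qed.
Let i0 : 'I_n := Ordinal n_gt0.

Lemma lorentzian_coord : exists2 Q : 'M[R]_n, Q \in unitmx &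
  forall u v : V, l u v = \sum_(i < n) (if (i == 0 :> nat)%N then 1 else -1) *
    (u *m Q) 0 i * (v *m Q) 0 i.
Proof.
have [P Pu lP] := lor; exists (invmx P); first by rewrite unitmx_inv.
move=> u v.
have E (w : V) : w = \sum_i (w *m invmx P) 0 i *: row i P.
  by rewrite -mulmx_sum_row mulmxKV.
rewrite {1}[u]E {1}[v]E sym_suml; apply: eq_bigr => i _.
rewrite symZl sym_sumr (bigD1 i)//= big1 => [|j ji].
  rewrite addr0 symZr lP eqxx mulrA [RHS]mulrC [RHS]mulrA [RHS]mulrAC.
  by rewrite [X in X * _]mulrC.
by rewrite symZr lP eq_sym (negbTE ji) mulr0.
Qed.

Lemma lorentzian_nondeg (x : V) : (forall y, l x y = 0) -> x = 0.
Proof.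
have [P Pu lP] := lor => lx0.
have := lx0; have -> : x = \sum_i (x *m invmx P) 0 i *: row i P.
  by rewrite -mulmx_sum_row mulmxKV.
move=> H; rewrite big1 // => i _; have := H (row i P).
rewrite sym_suml (bigD1 i)//= big1 => [|j ji]; last first.
  by rewrite symZl lP (negbTE ji) mulr0.
rewrite addr0 symZl lP eqxx => /eqP.
by rewrite mulf_eq0; case: ifP => _; rewrite ?oppr_eq0 oner_eq0 orbF => /eqP->;
  rewrite scale0r.
Qed.

(** If [l x x] were nonnegative, the form would be nonnegative on all combinations of [p] and [x],
    whereas a combination without timelike coordinate has negative square unless it is zero. *)
Lemma timelike_orth (p x : V) : 0 < l p p -> l x p = 0 -> x != 0 -> l x x < 0.
Proof.
move=> pp xp x0; rewrite ltNge; apply/negP => xx.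
have [Q Qu lQ] := lorentzian_coord.
pose xc := (x *m Q) 0 i0; pose pc := (p *m Q) 0 i0.
(* The coefficients cancel the timelike coordinate of [y]. *)
pose y := xc *: p - pc *: x.
have yE : l y y = xc ^+ 2 * l p p + pc ^+ 2 * l x x.
  rewrite /y !symE.
  by rewrite [l p x]symC xp; ring.
have yc : (y *m Q) 0 i0 = 0.
  by rewrite /y mulmxBl -!scalemxAl !mxE -/xc -/pc /xc /pc !mxE; ring.
have yle : l y y = - \sum_(i | i != i0) (y *m Q) 0 i ^+ 2.
  rewrite lQ (bigD1 i0)//= yc mulr0 add0r -sumrN; apply: eq_bigr => i ii0.
  by rewrite -val_eqE/= in ii0; rewrite (negbTE ii0); ring.
have nn i : i != i0 -> 0 <= (y *m Q) 0 i ^+ 2 by rewrite sqr_ge0.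
have yy0 : \sum_(i | i != i0) (y *m Q) 0 i ^+ 2 = 0.
  apply/eqP; rewrite eq_le sumr_ge0// andbT -oppr_ge0 -yle yE.
  by rewrite addr_ge0// mulr_ge0 ?sqr_ge0// ltW.
have y0 : y = 0.
  apply: (can_inj (mulmxK Qu)); rewrite mul0mx; apply/rowP => i; rewrite [RHS]mxE.
  have [->//|ii0] := eqVneq i i0.
  by move/psumr_eq0P: yy0 => /(_ nn i ii0)/eqP; rewrite sqrf_eq0 => /eqP.
have := yE; rewrite y0 sym0l => /esym/eqP; rewrite paddr_eq0; first last.
- by rewrite mulr_ge0 ?sqr_ge0.
- by rewrite mulr_ge0 ?sqr_ge0// ltW.
rewrite mulf_eq0 sqrf_eq0 (gt_eqF pp) orbF => /andP[/eqP xc0 _].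
move: y0; rewrite /y xc0 scale0r add0r => /eqP.
rewrite oppr_eq0 scaler_eq0 (negbTE x0) orbF => /eqP pc0.
move: pp; rewrite lQ (bigD1 i0)//= -/pc pc0 mulr0 add0r ltNge => /negP; apply.
apply: sumr_le0 => i; rewrite -val_eqE/= => /negbTE ->.
by rewrite mulN1r mulNr oppr_le0 -expr2 sqr_ge0.
Qed.

(** Since [n] is at least 2, the orthogonal complement of [p] is nonzero, and any nonzero vector in
    it is spacelike. *)
Lemma timelike_orth_exists (p : V) : 0 < l p p -> exists2 z, l p z = 0 & l z z < 0.
Proof.
move=> pp; pose W := (fullv :&: orthov l <[p]>)%VS.
have W0 : (0 < \dim W)%N.
  apply: leq_trans (leq_dim_orthov1 l p fullv).
  by rewrite dimvf /dim /= mul1n -ltnS prednK.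
exists (vpick W).
  have : vpick W \in W by rewrite memv_pick.
  by rewrite memv_cap memvf /= mem_orthov1 symC => /eqP.
have : vpick W \in W by rewrite memv_pick.
rewrite memv_cap memvf /= mem_orthov1 => /eqP zp.
apply: timelike_orth pp zp _.
by rewrite vpick0 -dimv_eq0 -lt0n.
Qed.

(* If [v] were timelike it would lie in both cones, as it is not interior to
   [K].  One of them contains [- v + e *: z], so their sum [e *: z], which is
   spacelike, lies in a cone. *)
Lemma boundary_null (K : set V) (v : V) : causal_cone l K -> boundary K v ->
  l v v = 0.
Proof.
move=> [[clK K0 KD KZ] [K' [clK' K'0 K'D K'Z] KK']] [vK vnK].
have {}vK : K v by apply: clK.
have vv : 0 <= l v v.
  have : (K `|` K') v by left.
  by rewrite KK'.
apply/eqP; rewrite eq_le vv andbT leNgt; apply/negP => {}vv.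
have lcont : continuous (fun x => l x x).
  move=> x; suff /differentiable_continuous : differentiable (fun x => l x x) x by [].
  rewrite (_ : (fun x => l x x) = \sum_(i < n) \sum_(j < n)
    (fun x : V => x 0 i * x 0 j * l 'e_i 'e_j)).
    apply: differentiable_sum => i; apply: differentiable_sum => j.
    by apply: differentiableM => //; apply: differentiableM => //; exact: differentiable_coord.
  apply/funext => y; rewrite form_coord fct_sumE; apply: eq_bigr => i _.
  by rewrite fct_sumE.
have K'v : K' v.
  apply: clK' => B Bv.
  have Pv : nbhs v [set x | 0 < l x x].
    apply: (@open_nbhs_nbhs V); split=> //.
    by apply: (@open_comp V R (fun x => l x x) [set x | 0 < x]) => //; apply: open_gt.
  apply: contrapT => nex; apply: vnK.
  apply: filterS (filterI Bv Pv) => x [Bx Px]; apply: contrapT => nKx.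
  apply: nex; exists x; split => //.
  have : (K `|` K') x by rewrite KK' /= ltW.
  by case.
have [z vz zz] := timelike_orth_exists vv.
have [e e0 we] : exists2 e, 0 < e & 0 <= l (e *: z - v) (e *: z - v).
  pose q := - l z z; have q0 : 0 < q by rewrite oppr_gt0.
  have [e e0 eq] : exists2 e : R, 0 < e & e ^+ 2 * q <= l v v.
    (* Being at most 1, this number dominates its own square, which is therefore at most
       [l v v / q]. *)
    exists (Num.min 1 (l v v / q)); first by rewrite lt_min ltr01 divr_gt0.
    rewrite -ler_pdivlMr// expr2.
    set m := Num.min _ _; have m0 : 0 <= m by rewrite le_min ler01 divr_ge0 ?ltW.
    have m1 : m <= 1 by rewrite ge_min lexx.
    have mq : m <= l v v / q by rewrite ge_min lexx orbT.
    by rewrite (le_trans _ mq)// -[leRHS]mulr1 ler_wpM2l.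
  exists e => //; rewrite !symE.
  rewrite [l z v]symC vz; move: eq; rewrite /q; nra.
have : 0 <= l (e *: z) (e *: z).
  have : (K `|` K') (e *: z - v) by rewrite KK'.
  rewrite -[X in _ -> 0 <= l X X](subrK v).
  move=> [Kw|Kw].
    have : (K `|` K') ((e *: z - v) + v) by left; apply: KD.
    by rewrite KK'.
  have : (K `|` K') ((e *: z - v) + v) by right; apply: K'D.
  by rewrite KK'.
rewrite !symE leNgt => /negP; apply.
by rewrite mulrA -expr2 pmulr_rlt0// exprn_gt0.
Qed.

(** The span of [v0] and [v1] contains a timelike vector, and all of [N] is orthogonal to it. *)
Lemma Nspace_neg (v0 v1 x : V) : l v0 v0 = 0 -> l v0 v1 = 1 ->
  x \in Nspace l v0 v1 -> x != 0 -> l x x < 0.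
Proof.
move=> l00 l01; rewrite memv_cap !mem_orthov1 => /andP[/eqP x0 /eqP x1].
(* The coefficient of [v0] is chosen so that the square of this vector is 2, whatever [l v1 v1]
   is. *)
apply: (@timelike_orth (v1 + (1 - 2^-1 * l v1 v1) *: v0)).
  rewrite !symE l00 [l v1 v0]symC l01.
  lra.
by rewrite !symE x0 x1 mulr0 addr0.
Qed.

Lemma dim_Nspace (v0 v1 : V) : l v0 v0 = 0 -> l v0 v1 = 1 ->
  \dim (Nspace l v0 v1) = (n - 2)%N.
Proof.
move=> l00 l01; have nz : (1 : R) != 0 by rewrite oner_eq0.
rewrite /Nspace -(@eq_dim_orthov1 _ _ _ _ l v1 (orthov l <[v0]>)).
  rewrite -[(orthov l <[v0]>)%VS]capfv -eq_dim_orthov1 ?dimvf.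
    by rewrite /dim /= mul1n -!subn1 -subnDA.
  by apply/mem_orthovPn; exists v1; rewrite ?memvf ?l01.
apply/mem_orthovPn; exists v0; last by rewrite symC l01.
by rewrite mem_orthov1 l00.
Qed.

End LorentzianForm.

Section Realization.
Variables (R : realType) (n : nat) (rho : realization R n).
Local Notation V := 'rV[R]_n.
Local Notation l := (rform rho).
Local Notation v0 := (rv0 rho).
Local Notation v1 := (rv1 rho).
Local Notation T := (rT rho).
Local Notation N := (Nspace (rform rho) (rv0 rho) (rv1 rho)).
Local Notation G := (rGamma rho).
Local Notation "''a' x" := (vsval (ra rho x)) (at level 10, x at level 8).

Lemma realization_ge2 : (2 <= n)%N. Proof. by case: rho. Qed.

Lemma realization_lorentzian : lorentzian l. Proof. by case: rho. Qed.

Lemma realization_nondeg (x : V) : (forall y, l x y = 0) -> x = 0.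
Proof. exact: (lorentzian_nondeg realization_lorentzian). Qed.

Lemma rv0_null : l v0 v0 = 0.
Proof.
apply: (boundary_null realization_ge2 realization_lorentzian (K := rcone rho));
  by case: rho.
Qed.

Lemma rv0_rv1 : l v0 v1 = 1. Proof. by case: rho. Qed.

Lemma rT_sub : (T <= N)%VS. Proof. by case: rho. Qed.

Lemma rGamma_lattice : lattice T G. Proof. by case: rho. Qed.

Lemma ra_sym (x y : subvs_of T) : l ('a x) (vsval y) = l (vsval x) ('a y).
Proof. by move: x y; case: rho. Qed.

Lemma ra_inj s (x : subvs_of T) : vsval x + s *: 'a x = 0 -> x = 0.
Proof. by move: s x; case: rho. Qed.

Lemma N_neg (x : V) : x \in N -> x != 0 -> l x x < 0.
Proof.
exact: (Nspace_neg realization_ge2 realization_lorentzian rv0_null rv0_rv1).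
Qed.

Lemma N_le0 (x : V) : x \in N -> l x x <= 0.
Proof.
by move=> xN; have [->|x0] := eqVneq x 0; [rewrite sym0l|exact/ltW/N_neg].
Qed.

Lemma N_v0 (x : V) : x \in N -> l x v0 = 0.
Proof. by rewrite memv_cap !mem_orthov1 => /andP[/eqP]. Qed.

Lemma N_v1 (x : V) : x \in N -> l x v1 = 0.
Proof. by rewrite memv_cap !mem_orthov1 => /andP[_ /eqP]. Qed.

Lemma T_N (x : subvs_of T) : vsval x \in N.
Proof. exact: (subvP rT_sub _ (subvsP x)). Qed.

Lemma l_v0T (x : subvs_of T) : l v0 (vsval x) = 0.
Proof. by rewrite symC N_v0// T_N. Qed.

Lemma l_v0a (x : subvs_of T) : l v0 ('a x) = 0.
Proof. by rewrite symC N_v0// subvsP. Qed.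

Definition action_linear (x : subvs_of T) (v : V) : V :=
  v + l v0 v *: 'a x
  - (l ('a x) v + 2^-1 * l v0 v * l ('a x) ('a x)) *: v0.

Lemma action_linear_is_linear x : linear (action_linear x).
Proof.
move=> c u v; rewrite /action_linear !symE.
apply/rowP => i; rewrite !mxE; ring.
Qed.

Lemma actionE (x : subvs_of T) v : action x v = action_linear x v + action x 0.
Proof.
rewrite {1}/action -/(action_linear x v); congr (_ + _).
by rewrite /action !sym0r mulr0 mul0r addr0 !scale0r subr0 !add0r.
Qed.

Lemma action0 v : action (0 : subvs_of T) v = v.
Proof.
by rewrite /action !linear0 !sym0l; apply/rowP => i; rewrite !mxE; ring.
Qed.

Lemma l_v0_action (x : subvs_of T) v : l v0 (action x v) = l v0 v.
Proof.
by rewrite /action !symE rv0_null l_v0T l_v0a !mulr0 oppr0 !addr0.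
Qed.

(** The composition has the cross term [l (a x) y] along [v0], while [x + y] gives the mean of
    [l (a x) y] and [l (a y) x]; the symmetry of [a] makes them equal. *)
Lemma actionD (x y : subvs_of T) v : action x (action y v) = action (x + y) v.
Proof.
rewrite {1}/action l_v0_action {2 3}/action !linearD /=.
rewrite !symE [l ('a x) v0]symC l_v0a [l ('a y) ('a x)]symC.
rewrite [l ('a y) (vsval x)]symC -[l (vsval x) ('a y)]ra_sym.
rewrite {1}/action; apply/rowP => i; rewrite !mxE; field; done.
Qed.

Lemma orbit_refl v : orbit rho v v.
Proof.
exists 0; last by rewrite action0.
by have [_ [G0 _] _ _] := rGamma_lattice; rewrite linear0.
Qed.

Lemma orbit_action (x : subvs_of T) v : G (vsval x) -> orbit rho (action x v) = orbit rho v.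
Proof.
have [_ [G0 GB] _ _] := rGamma_lattice => Gx.
apply/seteqP; split=> _ [y Gy ->].
  exists (y + x); last by rewrite actionD.
  rewrite linearD /=.
  have -> : vsval y + vsval x = vsval y - (0 - vsval x) by rewrite sub0r opprK.
  by apply: (GB _ _ Gy (GB _ _ G0 Gx)).
exists (y - x); last by rewrite actionD subrK.
by rewrite linearB; apply: (GB _ _ Gy Gx).
Qed.

Lemma orbit_eq v w : orbit rho v = orbit rho w ->
  exists2 x : subvs_of T, G (vsval x) & v = action x w.
Proof. by move=> e; have := orbit_refl v; rewrite e. Qed.

(** Modulo [v0], the displacement of [v] is the vector [(1 + s a) x] with [s = l v0 v]. *)
Lemma action_displacement (x : subvs_of T) v : exists c : R,
  action x v - v = vsval x + l v0 v *: 'a x + c *: v0.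
Proof.
exists (- (l ('a x) v + 2^-1 * l v0 v * l ('a x) ('a x)
  + 2^-1 * l ('a x) (vsval x))).
by rewrite /action; apply/rowP => i; rewrite !mxE; ring.
Qed.

(** The image of [a], taken in the ambient space so that it can be added to [T]. *)
Definition imageN : {vspace V} := ((linfun vsval \o ra rho) @: fullv)%VS.

Lemma mem_imageN x : 'a x \in imageN.
Proof.
apply/memv_imgP; exists x; first by rewrite memvf.
by rewrite comp_lfunE lfunE.
Qed.

Lemma imageNP v : reflect (exists x, v = 'a x) (v \in imageN).
Proof.
apply: (iffP memv_imgP) => [[x _ ->]|[x ->]].
  by exists x; rewrite comp_lfunE lfunE.
by exists x; [rewrite memvf|rewrite comp_lfunE lfunE].
Qed.

Lemma imageN_sub : (imageN <= N)%VS.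
Proof. by apply/subvP => _ /imageNP[x ->]; exact: subvsP. Qed.

Definition displacement_space : {vspace V} := (<[v0]> + (T + imageN))%VS.

Lemma dim_displacement_space :
  \dim displacement_space = (\dim (T + imageN)).+1.
Proof.
have disj : (<[v0]> :&: (T + imageN) = 0)%VS.
  apply/eqP; rewrite -subv0; apply/subvP => x; rewrite memv_cap memv0.
  case/andP=> /vlineP[c ->] cN; have : c *: v0 \in N.
    by apply: subvP cN; rewrite subv_add rT_sub imageN_sub.
  by move/N_v1; rewrite symZl rv0_rv1 mulr1 => ->; rewrite scale0r.
rewrite (dimv_disjoint_sum disj) dim_vline; case: eqP => // v00.
by have := rv0_rv1; rewrite v00 sym0l => /esym/eqP; rewrite oner_eq0.
Qed.

Lemma action_sub_displacement (x : subvs_of T) v : action x v - v \in displacement_space.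
Proof.
have [c ->] := action_displacement x v; rewrite addrC memv_add ?memvZ ?memv_line//.
by rewrite memv_add ?subvsP ?memvZ ?mem_imageN.
Qed.

End Realization.

(** * Lattices and the span of the displacements *)

Lemma coord_norm (R : realType) (m n : nat) (x : 'M[R]_(m, n)) i j :
  `|x i j| <= `|x|.
Proof.
by rewrite [leRHS]/Num.norm /= mx_normrE; exact: (le_bigmax _ _ (i, j)).
Qed.

Lemma linear_rV_bounded (R : realType) (n : nat) (W : normedModType R)
    (f : {linear 'rV[R]_n -> W}) :
  exists2 K : R, 0 < K & forall x, `|f x| <= K * `|x|.
Proof.
exists (1 + \sum_(i < n) `|f 'e_i|).
  by rewrite ltr_wpDr// sumr_ge0.
move=> x; rewrite {1}[x]row_sum_delta linear_sum.
apply: le_trans (ler_norm_sum _ _ _) _.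
rewrite mulrDl mul1r -[leLHS]add0r lerD// mulr_suml ler_sum// => i _.
by rewrite linearZ normrZ mulrC ler_wpM2l// coord_norm.
Qed.

Lemma linear_rV_continuous (R : realType) (n : nat) (W : normedModType R)
    (f : {linear 'rV[R]_n -> W}) : continuous f.
Proof.
have [K K0 fK] := linear_rV_bounded f => x.
apply/(@cvgrPdist_lt _ _ _ (nbhs (x : 'rV[R]_n))) => e e0.
have eK : 0 < e / K by rewrite divr_gt0.
apply: filterS (nbhsx_ballx x _ eK) => y; rewrite -ball_normE /= => xy.
by rewrite -linearB (le_lt_trans (fK _))// mulrC -ltr_pdivlMr.
Qed.

(** The linear map [\1 - projv S] kills [G], and every point of [T] differs from a point of [G] by
    an element of a compact set. The map is therefore bounded on [T], and being bounded on all
    multiples of [x] it vanishes at [x]. *)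
Lemma lattice_span (R : realType) (n : nat) (T S : {vspace 'rV[R]_n})
    (G : set 'rV[R]_n) : lattice T G -> (forall y, G y -> y \in S) -> (T <= S)%VS.
Proof.
move=> [_ _ _ [K [Kc _ KG]]] GS; apply/subvP => x xT.
have [B B0 KB] : exists2 B : R, 0 < B & forall y, K y -> `|y| < B.
  have [B B0 KB] := ex_strict_bound_gt0 (compact_bounded Kc).
  by exists B.
have [D D0 fD] := @linear_rV_bounded R n 'rV[R]_n (fun_of_lfun (\1 - projv S)%VF).
have fS y : y \in S -> (\1 - projv S)%VF y = 0.
  by move=> yS; rewrite add_lfunE opp_lfunE id_lfunE projv_id// subrr.
have bound k : `|(\1 - projv S)%VF x| *+ k <= D * B.
  have [|y Gy Ky] := KG (x *+ k); first by rewrite rpredMn.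
  rewrite -normrMn -linearMn/= -(subrK y (x *+ k)) linearD/= (fS y) ?GS// addr0.
  by apply: le_trans (fD _) _; rewrite ler_pM2l// ltW// KB.
suff fx0 : (\1 - projv S)%VF x = 0.
  move/eqP: fx0; rewrite add_lfunE opp_lfunE id_lfunE subr_eq0 => /eqP ->.
  exact: memv_proj.
apply/eqP; rewrite -normr_eq0 eq_le normr_ge0 andbT leNgt; apply/negP => fx.
have := bound (Num.bound (D * B / `|(\1 - projv S)%VF x|)).
rewrite leNgt -mulr_natl -ltr_pdivrMr// => /negP; apply.
by apply: archi_boundP; rewrite divr_ge0 ?mulr_ge0 ?ltW.
Qed.

Section Displacements.
Variables (R : realType) (n : nat) (rho : realization R n).
Local Notation l := (rform rho).
Local Notation v0 := (rv0 rho).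
Local Notation T := (rT rho).
Local Notation G := (rGamma rho).
Local Notation "''a' x" := (vsval (ra rho x)) (at level 10, x at level 8).

(** The lattice spans [T], so linear conditions on [x] need only be checked on [G]. If [v0] were not
    in [S], then [a] would vanish on [G], hence everywhere. With [v0] in [S], the displacements of
    [0] put [T] into [S], and those of [rv1 rho] put the image of [a] there. *)
Lemma displacement_space_min (S : {vspace 'rV[R]_n}) : ra rho != 0 ->
  (forall (x : subvs_of T) v, G (vsval x) -> action x v - v \in S) ->
  (displacement_space rho <= S)%VS.
Proof.
move=> a0 GS.
have subT (W : {vspace 'rV[R]_n}) :
    (forall x : subvs_of T, G (vsval x) -> vsval x \in W) ->
    forall x : subvs_of T, vsval x \in W.
  move=> GW x; have [GT _ _ _] := rGamma_lattice rho.
  apply: (subvP (lattice_span (rGamma_lattice rho) _) _ (subvsP x)) => y Gy.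
  have := GW (vsproj T y); rewrite vsprojK ?(GT _ Gy)//; apply.
  exact: Gy.
have v0S : v0 \in S.
  apply: contrapT => nv0; case/negP: a0; apply/eqP.
  have aG0 (x : subvs_of T) : G (vsval x) -> ra rho x = 0.
    move=> Gx; apply: contrapT => ax0; apply: nv0.
    have axn : 'a x != 0 by apply/eqP => /(@subvs_inj _ _ _ _ 0).
    (* Subtracting the displacement of [0] removes the translation part. What remains at the vector
       [a x] is [- l (a x) (a x)] times [v0], with a nonzero coefficient because the form is
       definite on [N]. *)
    have D : action x ('a x) - 'a x - (action x 0 - 0) \in S.
      by rewrite memvB// GS.
    rewrite subr0 actionE addrAC addrK in D.
    move: D; rewrite /action_linear l_v0a scale0r addr0 mulr0 mul0r addr0.
    rewrite addrAC subrr add0r memvN => D.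
    have := memvZ (l ('a x) ('a x))^-1 D; rewrite scalerA mulVf ?scale1r//.
    by rewrite lt_eqF// N_neg// subvsP.
  apply/lfunP => x; rewrite zero_lfunE.
  have := subT (linfun vsval @: lker (ra rho))%VS.
  move=> /(_ _ x)/memv_imgP[y Gy|y yk].
    apply/memv_imgP; exists y; rewrite ?lfunE// memv_ker.
    by apply/eqP/aG0.
  by rewrite lfunE/= => /subvs_inj ->; move: yk; rewrite memv_ker => /eqP.
have TS (x : subvs_of T) : vsval x \in S.
  apply: subT x => x Gx; have := GS x 0 Gx.
  have [c ->] := action_displacement x 0.
  by rewrite sym0r scale0r addr0 rpredDr// memvZ.
rewrite !subv_add; apply/and3P; split.
- by apply/subvP => _ /vlineP[c ->]; exact: memvZ.
- by apply/subvP => x xT; rewrite -(vsprojK xT).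
apply/subvP => _ /imageNP[x ->].
have := subT (linfun vsval @: ((linfun vsval \o ra rho) @^-1: S))%VS.
move=> /(_ _ x)/memv_imgP[y Gy|y yk].
  apply/memv_imgP; exists y; rewrite ?lfunE//= -memv_preim comp_lfunE lfunE.
  (* As [l v0 v1 = 1], this displacement is [y + a y] modulo [v0]. *)
  have := GS y (rv1 rho) Gy; have [c ->] := action_displacement y (rv1 rho).
  rewrite rv0_rv1 scale1r rpredDr ?memvZ// => h.
  by rewrite -[X in X \in S](addKr (vsval y)) rpredD// rpredN.
rewrite lfunE/= => /subvs_inj ->.
by move: yk; rewrite -memv_preim comp_lfunE lfunE.
Qed.

End Displacements.

(** The component [a''] takes values orthogonal to [T], and the form is definite on [N]; hence
    [T + aT] is the direct sum of [T] and the image of [a'']. *)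
Lemma signature_dim (R : realType) (n : nat) (rho : realization R n)
    (n' m r k : nat) : realization_signature rho (n', m, r, k) ->
  [/\ \dim (rT rho) = m, \dim (rT rho + imageN rho) = (m + r)%N &
      \dim (lker (ra rho)) = k].
Proof.
move=> [a' [a'' [aE a'E [_ -> -> ->]]]]; split=> //.
pose S : {vspace 'rV[R]_n} := (linfun vsval @: limg a'')%VS.
have orth (x y : subvs_of (rT rho)) :
    rform rho (vsval (a'' x)) (vsval y) = 0.
  by have := a'E x y; rewrite aE symDl => /esym/eqP; rewrite -subr_eq0 addrC addKr
    => /eqP.
have SP v : reflect (exists x, v = vsval (a'' x)) (v \in S).
  apply: (iffP memv_imgP) => [[_ /memv_imgP[x _ ->] ->]|[x ->]].
    by exists x; rewrite lfunE.
  by exists (a'' x); rewrite ?lfunE// memv_img ?memvf.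
have TS : (rT rho + imageN rho = rT rho + S)%VS.
  apply/eqP; rewrite eqEsubv !subv_add !addvSl /=; apply/andP; split.
    apply/subvP => _ /imageNP[x ->]; rewrite aE memv_add ?subvsP//.
    by apply/SP; exists x.
  apply/subvP => _ /SP[x ->].
  have -> : vsval (a'' x) = - vsval (a' x) + vsval (ra rho x).
    by rewrite aE addrA addNr add0r.
  by rewrite memv_add ?memvN ?subvsP ?mem_imageN.
have disj : (rT rho :&: S = 0)%VS.
  apply/eqP; rewrite -subv0; apply/subvP => x; rewrite memv_cap memv0.
  move=> /andP[xT /SP[y xy]]; apply: contraT => x0.
  have := N_neg (subvP (rT_sub rho) _ xT) x0.
  by rewrite {1}xy -(vsprojK xT) orth ltxx.
rewrite TS dimv_disjoint_sum//; congr (_ + _)%N.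
apply: limg_dim_eq; apply/eqP; rewrite -subv0; apply/subvP => x.
rewrite memv_cap memv_ker lfunE /= memv0 => /andP[_ /eqP x0].
by apply/eqP/subvs_inj; rewrite x0 linear0.
Qed.

(** * Isometries of quotients *)

HB.instance Definition _ (R : realType) (n : nat) (rho : realization R n)
    (x : subvs_of (rT rho)) :=
  GRing.isLinear.Build R 'rV[R]_n 'rV[R]_n _ (action_linear x)
    (action_linear_is_linear x).

Lemma form_bounded (R : realType) (n : nat) (l : {symmetric 'rV[R]_n}) u :
  exists2 K : R, 0 < K & forall x, `|l u x| <= K * `|x|.
Proof.
exists (1 + \sum_(i < n) `|l u 'e_i|).
  by rewrite ltr_wpDr// sumr_ge0.
move=> x; rewrite {1}[x]row_sum_delta sym_sumr.
apply: le_trans (ler_norm_sum _ _ _) _.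
rewrite mulrDl mul1r -[leLHS]add0r lerD// mulr_suml ler_sum// => i _.
by rewrite symZr normrM mulrC ler_wpM2l// coord_norm.
Qed.

(** An estimate for the next section: [d] is the distance between two lattice elements, [b] the norm
    of one of them, and [p], [q] are small variations. The term in [d] on the right is at most half
    of [d], so it can be absorbed on the left. *)
Lemma contraction_bound (R : realType) (d K c b e eta p q : R) :
  0 <= d -> 0 < K -> 0 < c -> 0 <= b -> 0 <= p < eta -> 0 <= q < eta ->
  K * c * eta <= 2^-1 -> K * (1 + c * b) * eta <= e / 2 ->
  d <= K * (p + q * (c * (b + d))) -> d < e.
Proof.
move=> d0 K0 c0 b0 /andP[p0 pe] /andP[q0 qe] h1 h2 hd.
have cb : 0 <= c * b by rewrite mulr_ge0// ltW.
have cd : 0 <= c * d by rewrite mulr_ge0// ltW.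
have e1 : K * (p + q * (c * (b + d))) < K * (eta + eta * (c * b)) + K * (eta * (c * d)).
  rewrite -mulrDr ltr_pM2l// -addrA ltr_leD// -mulrDr -mulrDr.
  by rewrite mulrDr ler_wpM2r ?addr_ge0// ltW.
have e2 : K * (eta * (c * d)) <= 2^-1 * d.
  have -> : K * (eta * (c * d)) = (K * c * eta) * d by ring.
  by rewrite ler_wpM2r.
have e3 : K * (eta + eta * (c * b)) = K * (1 + c * b) * eta by ring.
move: (le_lt_trans hd e1) h2; rewrite e3 => *; lra.
Qed.

Section Displacement.
Variables (R : realType) (n : nat) (rho : realization R n).
Local Notation V := 'rV[R]_n.
Local Notation l := (rform rho).
Local Notation v0 := (rv0 rho).
Local Notation v1 := (rv1 rho).
Local Notation T := (rT rho).
Local Notation G := (rGamma rho).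
Local Notation "''a' x" := (vsval (ra rho x)) (at level 10, x at level 8).

Lemma isolated_lattice (y : V) : G y ->
  exists2 e, 0 < e & forall z, G z -> `|z - y| < e -> z = y.
Proof.
have [_ _ iso _] := rGamma_lattice rho => /iso[_ [W Wy WG]].
have [e /= e0 eW] := (nbhs_ballP _ _).1 Wy.
exists e => // z Gz zy; have : (W `&` G) z.
  by split=> //; apply: eW; rewrite -ball_normE /= distrC.
by rewrite WG.
Qed.

(* The displacement of [u] determines the group element, continuously in [u]
   since [1 + s a] has a left inverse. *)
Lemma orbit_eq_locally_constant (L1 L2 : 'End(V)) (c1 c2 w : V) (r : R) :
  0 < r ->
  (forall u, `|u - w| < r -> orbit rho (L1 u + c1) = orbit rho (L2 u + c2)) ->
  exists y : subvs_of T, G (vsval y) /\ exists2 d, 0 < d &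
    forall u, `|u - w| < d -> L1 u + c1 = action y (L2 u + c2).
Proof.
move=> r0 eqo.
have [y Gy ye] : exists2 y : subvs_of T, G (vsval y) & L1 w + c1 = action y (L2 w + c2).
  by apply: orbit_eq; apply: eqo; rewrite subrr normr0.
exists y; split=> //.
have [e e0 iso] := isolated_lattice Gy.
(* Pairing with [v1] reads off the [v0] component of a displacement. With that component removed,
   [g u] equals [(1 + s a) z] for the group element [z] relating the two points, where [s = s u]. *)
pose s u := l v0 (L2 u + c2).
pose g u := (L1 u + c1 - (L2 u + c2)) - l v1 (L1 u + c1 - (L2 u + c2)) *: v0.
have gE (z : subvs_of T) u : L1 u + c1 = action z (L2 u + c2) ->
    vsval z + s u *: 'a z = g u.
  move=> uz; rewrite /g uz; have [c ->] := action_displacement z (L2 u + c2).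
  rewrite !symE [l v1 (vsval z)]symC [l v1 ('a z)]symC.
  rewrite (N_v1 (T_N z)) (N_v1 (subvsP (ra rho z))) [l v1 v0]symC rv0_rv1.
  by rewrite /s symDr mulr0 mulr1 !add0r addrK.
(* The map [1 + s a] at the fixed parameter [s w]; its injectivity gives a left inverse [psi], which
   is bounded. *)
pose phi : 'Hom(subvs_of T, V) := (linfun vsval + s w *: (linfun vsval \o ra rho))%VF.
have phiE z : phi z = vsval z + s w *: 'a z.
  by rewrite add_lfunE scale_lfunE comp_lfunE !lfunE.
have phi0 : lker phi == 0%VS.
  rewrite -subv0; apply/subvP => z; rewrite memv_ker phiE memv0 => /eqP z0.
  by apply/eqP; exact: ra_inj z0.
pose psi : 'End(V) := (linfun vsval \o phi^-1)%VF.
have psiE z : psi (phi z) = vsval z.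
  by rewrite comp_lfunE lker0_lfunK// lfunE.
pose alpha : 'End(V) := (linfun vsval \o ra rho \o linfun (vsproj T))%VF.
have alphaE z : alpha (vsval z) = 'a z.
  by rewrite !comp_lfunE !lfunE /= vsvalK.
have [K K0 psiK] := @linear_rV_bounded R n 'rV[R]_n (fun_of_lfun psi).
have [c c0 alphac] := @linear_rV_bounded R n 'rV[R]_n (fun_of_lfun alpha).
have [S S0 sS] : exists2 S : R, 0 < S & forall u, `|s u - s w| <= S * `|u - w|.
  have [S1 S10 HS1] := form_bounded l v0.
  have [S2 S20 HS2] := @linear_rV_bounded R n 'rV[R]_n (fun_of_lfun L2).
  exists (S1 * S2) => [|u]; first by rewrite mulr_gt0.
  rewrite /s -symNr -symDr opprD addrACA subrr addr0 -linearB.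
  by apply: le_trans (HS1 _) _; rewrite -mulrA ler_pM2l.
have [D D0 gD] : exists2 D : R, 0 < D & forall u, `|g u - g w| <= D * `|u - w|.
  have [S1 S10 HS1] := form_bounded l v1.
  have [S2 S20 HS2] := @linear_rV_bounded R n 'rV[R]_n (fun_of_lfun (L1 - L2)%VF).
  exists (S2 + S1 * S2 * (`|v0| + 1)) => [|u].
    by rewrite addr_gt0// !mulr_gt0// ltr_wpDl.
  have -> : g u - g w = (L1 - L2)%VF (u - w) - l v1 ((L1 - L2)%VF (u - w)) *: v0.
    have -> : (L1 - L2)%VF (u - w) =
      (L1 u + c1 - (L2 u + c2)) - (L1 w + c1 - (L2 w + c2)).
      rewrite linearB/= !add_lfunE !opp_lfunE; apply/rowP => i; rewrite !mxE; ring.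
    by rewrite /g [in RHS]symDr symNr; apply/rowP => i; rewrite !mxE; ring.
  apply: le_trans (ler_normB _ _) _; rewrite mulrDl lerD ?HS2//.
  rewrite normrZ; apply: le_trans (_ : S1 * S2 * `|u - w| * (`|v0| + 1) <= _);
    last by rewrite mulrAC.
  rewrite ler_pM// ?lerDl//; apply: le_trans (HS1 _) _.
  by rewrite -mulrA ler_pM2l// HS2.
pose eta := Num.min (2^-1 / (K * c)) (e / 2 / (K * (1 + c * `|vsval y|))).
have Kc : 0 < K * c by rewrite mulr_gt0.
have Kcy : 0 < K * (1 + c * `|vsval y|).
  by rewrite mulr_gt0// ltr_wpDr// mulr_ge0// ltW.
have eta0 : 0 < eta by rewrite lt_min !divr_gt0.
exists (Num.min r (Num.min (eta / S) (eta / D))).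
  by rewrite !lt_min r0 !divr_gt0.
move=> u; rewrite !lt_min => /and3P[ur uS uD].
have [z Gz ze] := orbit_eq (eqo u ur).
rewrite ze; congr action; apply/subvs_inj/iso => //.
apply: (@contraction_bound R _ K c `|vsval y| e eta `|g u - g w| `|s u - s w|) => //.
- rewrite normr_ge0; apply: le_lt_trans (gD _) _.
  by rewrite mulrC -ltr_pdivlMr.
- rewrite normr_ge0; apply: le_lt_trans (sS _) _.
  by rewrite mulrC -ltr_pdivlMr.
- by rewrite mulrC -ler_pdivlMr// ge_min lexx.
- by rewrite mulrC -ler_pdivlMr// ge_min lexx orbT.
(* Replacing [s u] by [s w] in the equation for [z] costs [(s w - s u) *: a z], which is why the
   norm of [z], and so the distance itself, reappears in the bound. *)
have zy : vsval z - vsval y = psi ((g u - g w) + (s w - s u) *: 'a z).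
  have -> : vsval z - vsval y = psi (phi z - phi y) by rewrite linearB /= !psiE.
  by rewrite -(gE z u ze) -(gE y w ye) !phiE; congr (psi _); apply/rowP => i; rewrite !mxE; ring.
rewrite [X in `|X| <= _]zy; apply: le_trans (psiK _) _; rewrite ler_pM2l//.
apply: le_trans (ler_normD _ _) _; rewrite lerD// normrZ distrC ler_wpM2l//.
rewrite -alphaE; apply: le_trans (alphac _) _; rewrite ler_pM2l//.
by rewrite -{1}(subrK (vsval y) (vsval z)) addrC ler_normD.
Qed.

(** Near [w] the two sides are related by one fixed group element [y]. Since [y] acts affinely, this
    is an equality of affine maps on a ball, which holds everywhere. *)
Lemma orbit_eq_extend (L1 L2 : 'End(V)) (c1 c2 w : V) (r : R) : 0 < r ->
  (forall u, `|u - w| < r -> orbit rho (L1 u + c1) = orbit rho (L2 u + c2)) ->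
  forall u, orbit rho (L1 u + c1) = orbit rho (L2 u + c2).
Proof.
move=> r0 eqo u; have [y [Gy [d d0 He]]] := orbit_eq_locally_constant r0 eqo.
suff -> : L1 u + c1 = action y (L2 u + c2) by rewrite orbit_action.
pose t := d / (`|u - w| + 1) / 2.
have N0 : 0 < `|u - w| + 1 by rewrite ltr_wpDl.
have t0 : 0 < t by rewrite !divr_gt0.
have Hw := He w; rewrite subrr normr0 in Hw; have {}Hw := Hw d0.
have Ht := He (w + t *: (u - w)); rewrite addrC addKr in Ht.
have {}Ht : L1 (w + t *: (u - w)) + c1 = action y (L2 (w + t *: (u - w)) + c2).
  apply: Ht; rewrite normrZ gtr0_norm// /t mulrAC ltr_pdivrMr//.
  by rewrite mulrAC ltr_pdivrMr// -mulrA ltr_pM2l// mulrC mulrDl mul1r; lra.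
pose A : 'End(V) := linfun (action_linear y); pose k := action y 0.
have aE v : action y v = A v + k by rewrite actionE lfunE.
have LD (L : 'End(V)) b : L (w + b *: (u - w)) = L w + b *: L (u - w).
  by rewrite linearD linearZ.
have AD a b c : A (a + t *: b + c) = A a + t *: A b + A c.
  by rewrite [LHS]linearD linearD linearZ.
have AD1 a b c : A (a + b + c) = A a + A b + A c by rewrite !linearD.
have Lu (L : 'End(V)) : L u = L w + L (u - w).
  by rewrite -linearD addrC subrK.
have E : L1 (u - w) = A (L2 (u - w)).
  apply: (scalerI (lt0r_neq0 t0)).
  move: Ht; rewrite !LD aE AD; move: Hw; rewrite aE linearD.
  move=> /rowP Hw /rowP Ht; apply/rowP => i.
  by have := Hw i; have := Ht i; rewrite !mxE; lra.
by rewrite !Lu aE AD1 addrAC E Hw aE linearD; apply/rowP => i; rewrite !mxE; ring.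
Qed.

End Displacement.

Section Isometries.
Variables (R : realType) (n : nat) (M M' : realization R n).
Local Notation V := 'rV[R]_n.
Variable f : set V -> set V.
Hypothesis f_local : forall v : V, exists (U : set V) (h : V -> V),
  [/\ open_nbhs v U, smooth U h,
     (forall u, U u -> f (orbit M u) = orbit M' (h u)) &
     forall u, U u ->
       (forall w w', rform M' ('d h u w) ('d h u w') = rform M w w') /\
       'd h u @` rcone M = rcone M'].

Lemma isometry_locally_affine (v : V) : exists (L : 'End(V)) (c : V) (r : R),
  [/\ 0 < r, lker L = 0%VS &
     forall u, `|u - v| < r -> f (orbit M u) = orbit M' (L u + c)].
Proof.
have [U [h [[oU Uv] sh fh iso]]] := f_local v.
have isoh u : U u -> forall w w', rform M' ('d h u w) ('d h u w') = rform M w w'.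
  by move=> Uu; have [] := iso u Uu.
have [r /= r0 rU] := (nbhs_ballP _ _).1 (open_nbhs_nbhs (conj oU Uv)).
pose L : 'End(V) := linfun ('d h v : V -> V).
have dd0 u w z : U u -> 'D_w ('D_z h) u = 0.
  by move=> Uu; apply: (@local_isometry_dd R n (rform M) (rform M') _ _ U) => //;
    exact: realization_nondeg.
exists L, (h v - L v), r; split=> //.
  apply/eqP; rewrite -subv0; apply/subvP => x.
  rewrite memv_ker memv0 lfunE /= => /eqP x0.
  apply/eqP/(@realization_nondeg _ _ M) => y.
  by rewrite -(isoh v Uv) x0 sym0l.
move=> u ur; have ub : ball v r u by rewrite -ball_normE /= distrC.
rewrite fh; last exact: rU.
congr (orbit M' _).
have -> : h u = h v + 'd h v (u - v).
  by apply: (dd0_affine rU sh _ ub) => a b c Ua; exact: dd0.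
have LE a : L a = 'd h v a by rewrite lfunE.
rewrite -!LE linearB /=; apply/rowP => i; rewrite !mxE; ring.
Qed.

(** Let [E] consist of the points near which the affine lift found at the origin works. It is open
    by definition and closed by the extension lemma, so it contains the segment from [0] to any
    [u]. *)
Lemma isometry_affine : exists (L : 'End(V)) (c : V),
  lker L = 0%VS /\ forall u, f (orbit M u) = orbit M' (L u + c).
Proof.
have [L [c [r [r0 L0 fL]]]] := isometry_locally_affine 0.
exists L, c; split=> // u.
pose E : set V := [set w | exists2 d, 0 < d &
  forall z, `|z - w| < d -> f (orbit M z) = orbit M' (L z + c)].
have shrink (w : V) (d : R) (z : V) : `|z - w| < d -> forall y, `|y - z| < d - `|z - w| -> `|y - w| < d.
  move=> zd y yz; have -> : y - w = (y - z) + (z - w) by rewrite addrA subrK.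
  by apply: le_lt_trans (ler_normD _ _) _; rewrite -ltrBrDr.
have oE : open E.
  rewrite openE => w [d d0 Hd]; apply/nbhs_ballP; exists d => //= z.
  rewrite -ball_normE /= distrC => zw; exists (d - `|z - w|); first by rewrite subr_gt0.
  by move=> y yz; apply: Hd; exact: shrink yz.
have cE : closed E.
  move=> w wE; have [L1 [c1 [d [d0 _ Hd]]]] := isometry_locally_affine w.
  have [z [[e e0 He]]] := wE _ (nbhsx_ballx w d d0).
  rewrite -ball_normE /= distrC => zw.
  have e1 : 0 < Num.min e (d - `|z - w|) by rewrite lt_min e0 subr_gt0.
  (* The affine lift at [w] and the one from the origin give the same orbits near the point [z] of
     [E], hence everywhere. *)
  have ext := @orbit_eq_extend R n M' L1 L c1 c z _ e1.
  exists d => // y yw; rewrite Hd//; apply: ext => x.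
  rewrite lt_min => /andP[xe xd]; rewrite -He// Hd//; exact: shrink xd.
pose g (t : R) : V := t *: u.
have gc : continuous g.
  by move=> t; exact: scalel_continuous.
have Eu : E u.
  have H : (`[0, 1] `&` (g @^-1` E)) = `[0, 1]%classic.
    apply: (@segment_connected R 0 1).
    - exists 0; split; first by rewrite /= in_itv /= lexx ler01.
      by rewrite /= /g scale0r; exists r.
    - by exists (g @^-1` E) => //; apply: open_comp => // t _; exact: gc.
    - by exists (g @^-1` E) => //; apply: preimage_closed => // t _; exact: gc.
  have : (`[0, 1]%classic `&` g @^-1` E) 1.
    by rewrite H /= in_itv /= ler01 lexx.
  by rewrite /= /g scale1r => -[].
by have [d d0] := Eu; apply; rewrite subrr normr0.
Qed.

End Isometries.

(** * Displacements as an isometry invariant *)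

Section DisplacementDimension.
Variables (R : realType) (n : nat).
Local Notation V := 'rV[R]_n.

(** When [a = 0] the group acts by translations, and their displacements do not produce [v0]. *)
Definition displacements (rho : realization R n) : {vspace V} :=
  if ra rho == 0 then rT rho else displacement_space rho.

Lemma action_translation (rho : realization R n) (x : subvs_of (rT rho)) v :
  ra rho = 0 -> action x v - v = vsval x.
Proof.
move=> a0; rewrite /action a0 zero_lfunE linear0 !sym0l.
by apply/rowP => i; rewrite !mxE; ring.
Qed.

Lemma displacements_mem (rho : realization R n) (x : subvs_of (rT rho)) v :
  action x v - v \in displacements rho.
Proof.
rewrite /displacements; case: eqP => [a0|_].
  by rewrite action_translation// subvsP.
exact: action_sub_displacement.
Qed.

Lemma displacements_min (rho : realization R n) (S : {vspace V}) :
  (forall (x : subvs_of (rT rho)) v, rGamma rho (vsval x) ->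
    action x v - v \in S) ->
  (displacements rho <= S)%VS.
Proof.
move=> GS; rewrite /displacements; case: eqP => [a0|/eqP a0].
  apply: lattice_span (rGamma_lattice rho) _ => y Gy.
  have [GT _ _ _] := rGamma_lattice rho.
  have yT : y \in rT rho := GT _ Gy.
  have := GS (vsproj (rT rho) y) 0; rewrite action_translation// vsprojK//.
  exact.
exact: displacement_space_min.
Qed.

(** The affine lift carries orbits to orbits, so its linear part carries displacements to
    displacements. The inverse of the lift does the same, because [f] is injective on orbits. *)
Lemma isometric_dim_displacements (M M' : realization R n) : isometric M M' ->
  \dim (displacements M) = \dim (displacements M').
Proof.
move=> [f [[_ finj _] floc]].
have [L [c [L0 fL]]] := isometry_affine floc.
have L0' : lker L == 0%VS by rewrite L0.
have dimL : \dim (L @: displacements M) = \dim (displacements M).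
  by rewrite limg_dim_eq// L0 capv0.
apply/eqP; rewrite eqn_leq; apply/andP; split.
  rewrite -dimL; apply: dimvS.
  apply: (@subv_trans _ _ (L @: (L @^-1: displacements M'))%VS).
    apply: limgS; apply: displacements_min => x v Gx.
    rewrite -memv_preim linearB /=.
    have [y _ E] : exists2 y : subvs_of (rT M'), rGamma M' (vsval y) &
        L (action x v) + c = action y (L v + c).
      by apply: orbit_eq; rewrite -!fL orbit_action.
    have -> : L (action x v) - L v = action y (L v + c) - (L v + c).
      by rewrite -E opprD addrACA subrr addr0.
    exact: displacements_mem.
  by apply/subvP => _ /memv_imgP[z zD ->]; rewrite memv_preim.
rewrite -dimL; apply: dimvS; apply: displacements_min => y v' Gy.
pose inv v := (L^-1)%VF (v - c).
have invK v : L (inv v) + c = v.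
  by rewrite /inv (lker0_lfunVK L0') subrK.
have [x _ E] : exists2 x : subvs_of (rT M), rGamma M (vsval x) &
    inv (action y v') = action x (inv v').
  apply: orbit_eq; apply: finj; rewrite ?inE; try by eexists.
  by rewrite !fL !invK orbit_action.
have -> : action y v' - v' = L (action x (inv v') - inv v').
  by rewrite -E linearB /= -{1}(invK (action y v')) -{2}(invK v') opprD addrACA
    subrr addr0.
exact/memv_img/displacements_mem.
Qed.

End DisplacementDimension.

(** * Necessity *)

(** Stated for an arbitrary [b] to serve the products of [X] with [X], [X] with [Y] and [Y] with
    [Y]; in the mixed case the symmetry of [b] expresses that [a] is symmetric. *)
Lemma polarization (R : realType) (m : nat) (S : 'M[R]_m)
    (b : 'rV[R]_m -> 'rV[R]_m -> R) : S \is symmetricmx ->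
  (forall z w, b z w = b w z) ->
  (forall z w, b (z + w) (z + w) = b z z + b z w + (b w z + b w w)) ->
  (forall z, (z *m S *m z^T) 0 0 = b z z) ->
  forall z w, (z *m S *m w^T) 0 0 = b z w.
Proof.
move=> /symmetricmxP Ss bC bD Sb z w.
have wz : (w *m S *m z^T) 0 0 = (z *m S *m w^T) 0 0.
  have -> : w *m S *m z^T = (z *m S *m w^T)^T.
    by rewrite !trmx_mul trmxK Ss mulmxA.
  by rewrite mxE.
have := Sb (z + w); rewrite bD linearD !(mulmxDl, mulmxDr).
rewrite [LHS]mxE [X in X + _]mxE [X in _ + X]mxE wz !Sb [b w z]bC.
lra.
Qed.

(** The matrix [row_base F] has the same row space as [F], and multiplication by it is injective. *)
Lemma dim_limg_mulmxr (R : realType) (m n : nat) (F : 'M[R]_(m, n)) :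
  \dim (limg (linfun (mulmxr F : 'rV[R]_m -> 'rV[R]_n))) = \rank F.
Proof.
pose g := linfun (mulmxr (row_base F) : 'rV[R]_(\rank F) -> 'rV[R]_n).
have -> : limg (linfun (mulmxr F : 'rV[R]_m -> 'rV[R]_n)) = limg g.
  apply/eqP; rewrite eqEsubv; apply/andP; split; apply/subvP => _ /memv_imgP[z _ ->].
    rewrite lfunE /= -{1}(mulmx_base F) mulmxA.
    by apply/memv_imgP; exists (z *m col_base F); rewrite ?memvf ?lfunE.
  have /row_fullP[C CE] := col_base_full F.
  rewrite lfunE /=; apply/memv_imgP; exists (z *m C); rewrite ?memvf// lfunE /=.
  by rewrite -[in LHS](_ : C *m F = row_base F) ?mulmxA// -[RHS]mul1mx -CE -mulmxA
    mulmx_base.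
rewrite limg_dim_eq ?dimvf /dim /= ?mul1n//.
apply/eqP; rewrite -subv0; apply/subvP => z; rewrite memv_cap memv_ker lfunE /= memv0.
move=> /andP[_ /eqP z0]; have /row_freeP[C CE] := row_base_free F.
by rewrite -[z]mulmx1 -CE mulmxA z0 mul0mx.
Qed.

(** * The Schur complement as a Gram matrix *)

Section SchurComplement.
Variables (R : realType) (n m : nat) (rho : realization R n).
Variables (X Y : 'Hom('rV[R]_m, 'rV[R]_n)) (A B C : 'M[R]_m).
Local Notation l := (rform rho).
Local Notation N := (Nspace (rform rho) (rv0 rho) (rv1 rho)).
Local Notation D := (C - B *m invmx A *m B).
Hypotheses (symA : A \is symmetricmx) (symB : B \is symmetricmx)
  (symC' : C \is symmetricmx).
Hypotheses (XN : forall z, X z \in N) (YN : forall z, Y z \in N).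
Hypothesis XY_sym : forall z w, l (X z) (Y w) = l (X w) (Y z).
Hypothesis XY_inj : forall s z, X z + s *: Y z = 0 -> z = 0.
Hypothesis quad : forall s z, (z *m qpolymx A B C s *m z^T) 0 0 =
  - l (X z + s *: Y z) (X z + s *: Y z).

Let quadE s (z : 'rV[R]_m) : (z *m qpolymx A B C s *m z^T) 0 0 =
  (z *m A *m z^T) 0 0 + 2 * s * (z *m B *m z^T) 0 0
  + s ^+ 2 * (z *m C *m z^T) 0 0.
Proof.
rewrite /qpolymx !mulmxDr !mulmxDl -!scalemxAr -!scalemxAl.
by rewrite [LHS]mxE [X in X + _]mxE [X in _ + X + _]mxE [X in _ + X]mxE.
Qed.

Lemma qpolymx_coef z : [/\ (z *m A *m z^T) 0 0 = - l (X z) (X z),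
  (z *m B *m z^T) 0 0 = - l (X z) (Y z) &
  (z *m C *m z^T) 0 0 = - l (Y z) (Y z)].
Proof.
have H s : (z *m A *m z^T) 0 0 + 2 * s * (z *m B *m z^T) 0 0
  + s ^+ 2 * (z *m C *m z^T) 0 0 =
  - l (X z) (X z) - 2 * s * l (X z) (Y z) - s ^+ 2 * l (Y z) (Y z).
  by rewrite -quadE quad !symE [l (Y z) (X z)]symC; ring.
(* The values at three points determine the coefficients of a quadratic polynomial in [s]. *)
by have := H 0; have := H 1; have := H (-1); split; lra.
Qed.

Let HA z w : (z *m A *m w^T) 0 0 = - l (X z) (X w).
Proof.
apply: (polarization symA (b := fun z w => - l (X z) (X w))) => // [{}z {}w|{}z {}w|{}z].
- by rewrite symC.
- by rewrite linearD !symE; ring.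
- by have [] := qpolymx_coef z.
Qed.

Let HB z w : (z *m B *m w^T) 0 0 = - l (X z) (Y w).
Proof.
apply: (polarization symB (b := fun z w => - l (X z) (Y w))) => // [{}z {}w|{}z {}w|{}z].
- by rewrite XY_sym.
- by rewrite (linearD X) (linearD Y) !symE; ring.
- by have [] := qpolymx_coef z.
Qed.

Let HC z w : (z *m C *m w^T) 0 0 = - l (Y z) (Y w).
Proof.
apply: (polarization symC' (b := fun z w => - l (Y z) (Y w))) => // [{}z {}w|{}z {}w|{}z].
- by rewrite symC.
- by rewrite linearD !symE; ring.
- by have [] := qpolymx_coef z.
Qed.

Lemma qpolymx_posdef s : posdefmx (qpolymx A B C s).
Proof.
split.
  apply/symmetricmxP; rewrite /qpolymx !linearD !linearZ /=.
  by rewrite (symmetricmxP _ symA) (symmetricmxP _ symB) (symmetricmxP _ symC').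
move=> z z0; rewrite quad oppr_gt0 N_neg ?memvD ?memvZ//.
by apply: contra z0 => /eqP/XY_inj ->.
Qed.

Let A_posdef : posdefmx A.
Proof.
by have := qpolymx_posdef 0; rewrite /qpolymx mulr0 expr0n /= !scale0r !addr0.
Qed.

Let Au : A \in unitmx. Proof. exact: posdef_unit. Qed.

(** The subtracted term is the orthogonal projection of [Y z] to the image of [X], so [W] is the
    component of [Y] orthogonal to that image. *)
Let W : 'Hom('rV[R]_m, 'rV[R]_n) := (Y - (X \o linfun (mulmxr (B *m invmx A))))%VF.

Let WE z : W z = Y z - X (z *m (B *m invmx A)).
Proof. by rewrite add_lfunE opp_lfunE comp_lfunE lfunE. Qed.

Let WN z : W z \in N. Proof. by rewrite WE memvB. Qed.

Let XW z u : l (X z) (W u) = 0.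
Proof.
rewrite WE symDr symNr; have := HB z u; have := HA z (u *m (B *m invmx A)).
rewrite !trmx_mul trmx_inv (symmetricmxP _ symA) (symmetricmxP _ symB).
rewrite !mulmxA mulmxK// => h1 h2.
by apply/eqP; rewrite subr_eq0 -eqr_opp -h1 -h2.
Qed.

Let WW z u : (z *m D *m u^T) 0 0 = - l (W z) (W u).
Proof.
have -> : l (W z) (W u) = l (Y z) (Y u) - l (Y z) (X (u *m (B *m invmx A))).
  by rewrite {1}WE symDl symNl XW oppr0 addr0 WE symDr symNr.
have := HB (u *m (B *m invmx A)) z.
rewrite opprB [l (Y z) (X _)]symC => e.
rewrite mulmxBr mulmxBl [LHS]mxE HC addrC [X in X + _ = _]mxE; congr (_ + _).
rewrite -[RHS]opprK -e; congr (- _).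
have -> : u *m (B *m invmx A) *m B *m z^T = (z *m (B *m invmx A *m B) *m u^T)^T.
  by rewrite !trmx_mul trmxK trmx_inv (symmetricmxP _ symA) (symmetricmxP _ symB) !mulmxA.
by rewrite [in RHS]mxE.
Qed.

Lemma schur_nneg : nnegdefmx D.
Proof.
split; last by move=> z; rewrite WW oppr_ge0 N_le0.
apply/symmetricmxP; rewrite linearB /= !trmx_mul trmx_inv mulmxA.
by rewrite (symmetricmxP _ symA) (symmetricmxP _ symB) (symmetricmxP _ symC').
Qed.

(** The sum is the orthogonal direct sum of the images of [X] and [W]. The matrix [D] is minus the
    Gram matrix of [W], and definiteness on [N] gives it the same kernel as [W]. *)
Lemma rank_schur : \dim (limg X + limg Y) = (m + \rank D)%N.
Proof.
have rkD : \rank D = \dim (limg W).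
  rewrite -dim_limg_mulmxr; set E := linfun _.
  have := limg_ker_dim E fullv; have := limg_ker_dim W fullv.
  suff -> : lker E = lker W by lia.
  apply/vspaceP => z; rewrite !memv_ker lfunE /=.
  apply/eqP/eqP => z0.
    apply/eqP; apply: contraT => /(N_neg (WN z)).
    by rewrite -oppr_gt0 -WW z0 mul0mx mxE ltxx.
  by apply: mulmx_tr_eq0; rewrite WW z0 sym0l oppr0.
have -> : (limg X + limg Y = limg X + limg W)%VS.
  apply/eqP; rewrite eqEsubv !subv_add !addvSl /=; apply/andP; split;
    apply/subvP => _ /memv_imgP[z _ ->].
    have -> : Y z = X (z *m (B *m invmx A)) + W z by rewrite WE addrC subrK.
    by rewrite memv_add ?memv_img ?memvf.
  by rewrite WE addrC -linearN memv_add ?memv_img ?memvf.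
rewrite dimv_disjoint_sum.
  rewrite rkD; congr (_ + _)%N; rewrite limg_dim_eq ?dimvf /dim /= ?mul1n//.
  apply/eqP; rewrite -subv0; apply/subvP => z; rewrite memv_cap memv_ker memv0.
  move=> /andP[_ /eqP z0]; apply/eqP/(@XY_inj 0).
  by rewrite scale0r addr0.
apply/eqP; rewrite -subv0; apply/subvP => v; rewrite memv_cap memv0.
move=> /andP[/memv_imgP[z _ ->] /memv_imgP[u _ e]].
apply: contraT => /(N_neg (XN z)).
by rewrite {2}e XW ltxx.
Qed.

End SchurComplement.

(** The signature and the polynomial may come from different realizations, [rho2] and [rho].
    Everything is computed in [rho], and [r] is transported from [rho2] by the dimension of the
    displacements. *)
Lemma char_poly_necessary (R : realType) (m n r : nat) (A B C : 'M[R]_m)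
    (symA : A \is symmetricmx) (symB : B \is symmetricmx)
    (posC : posdefmx C) (M : unipotent_manifold R n) :
  signature M (n, m, r, 0%N) -> characteristic_polynomial M (qpolymx A B C) ->
  [/\ forall s : R, posdefmx (qpolymx A B C s),
      (m + r + 2 <= n)%N,
      nnegdefmx (C - B *m invmx A *m B) &
      r = \rank (C - B *m invmx A *m B)].
Proof.
move=> [rho2 iso2 sig2].
move=> [rho [iota [A1 [B1 [C1 [alpha [beta [iso1 [iota_bij _] _ qE [a0 q0E]]]]]]]]].
have symC0 := posC.1.
pose x : 'Hom('rV[R]_m, 'rV[R]_n) := (linfun vsval \o iota)%VF.
pose y : 'Hom('rV[R]_m, 'rV[R]_n) := (linfun vsval \o (ra rho \o iota))%VF.
have xE z : x z = vsval (iota z) by rewrite comp_lfunE lfunE.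
have yE z : y z = vsval (ra rho (iota z)) by rewrite !comp_lfunE lfunE.
(* The affine change of [s] is absorbed: [X] stands for [1 + beta a] and [Y] for [alpha a]. As
   [alpha] is nonzero, the images of [X] and [Y] still have sum [T + aT]. *)
pose X : 'Hom('rV[R]_m, 'rV[R]_n) := x + beta *: y.
pose Y : 'Hom('rV[R]_m, 'rV[R]_n) := alpha *: y.
have XE z : X z = x z + beta *: y z by rewrite add_lfunE scale_lfunE.
have YE z : Y z = alpha *: y z by rewrite scale_lfunE.
have yN z : y z \in Nspace (rform rho) (rv0 rho) (rv1 rho).
  by rewrite yE subvsP.
have YN z : Y z \in Nspace (rform rho) (rv0 rho) (rv1 rho).
  by rewrite YE memvZ.
have XN z : X z \in Nspace (rform rho) (rv0 rho) (rv1 rho).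
  by rewrite XE memvD ?memvZ// xE T_N.
have XYs z s : X z + s *: Y z = x z + (alpha * s + beta) *: y z.
  by rewrite XE YE scalerA [s * _]mulrC -addrA -scalerDl [beta + _]addrC.
have XY_sym z w : rform rho (X z) (Y w) = rform rho (X w) (Y z).
  have xy u v : rform rho (x u) (y v) = rform rho (x v) (y u).
    by rewrite !xE !yE -ra_sym symC.
  by rewrite !XE !YE !symE xy [rform rho (y z) (y w)]symC.
have XY_inj s z : X z + s *: Y z = 0 -> z = 0.
  rewrite XYs xE yE => /ra_inj/eqP.
  by rewrite -(linear0 iota) (inj_eq (bij_inj iota_bij)) => /eqP.
have quad s z : (z *m qpolymx A B C s *m z^T) 0 0 =
    - rform rho (X z + s *: Y z) (X z + s *: Y z).
  by rewrite q0E -qE /qform XYs xE yE.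
have rk := rank_schur symA symB symC0 XN YN XY_sym XY_inj quad.
have dimT : \dim (rT rho) = m.
  have : \dim (limg iota) = m.
    rewrite limg_dim_eq ?dimvf /dim /= ?mul1n//.
    apply/eqP; rewrite -subv0; apply/subvP => z; rewrite memv_cap memv_ker memv0.
    by move=> /andP[_]; rewrite -(linear0 iota) (inj_eq (bij_inj iota_bij)).
  have -> : limg iota = fullv.
    apply/eqP; rewrite eqEsubv subvf; apply/subvP => v _.
    have [g _ gK] := iota_bij.
    by apply/memv_imgP; exists (g v); rewrite ?memvf ?gK.
  by rewrite dimvf.
have limgXY : (limg X + limg Y = rT rho + imageN rho)%VS.
  have surj v : exists z, v = iota z.
    by have [g _ gK] := iota_bij; exists (g v).
  apply/eqP; rewrite eqEsubv; apply/andP; split.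
    rewrite subv_add; apply/andP; split; apply/subvP => _ /memv_imgP[z _ ->].
      by rewrite XE xE yE memv_add ?subvsP// memvZ// mem_imageN.
    rewrite YE yE; apply: (subvP (addvSr _ _)).
    by rewrite memvZ// mem_imageN.
  have yXY z : y z \in limg Y.
    have -> : y z = alpha^-1 *: Y z by rewrite YE scalerA mulVf ?scale1r// gt_eqF.
    by rewrite memvZ// memv_img ?memvf.
  rewrite subv_add; apply/andP; split; apply/subvP => v.
    move=> vT; have [z zv] := surj (vsproj (rT rho) v).
    have -> : v = X z - beta *: y z by rewrite XE addrK xE -zv vsprojK.
    by rewrite memv_add ?memvN ?memvZ// memv_img ?memvf.
  move=> /imageNP[u ->]; have [z ->] := surj u.
  by rewrite -yE; apply: (subvP (addvSr _ _)).
rewrite limgXY in rk.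
have [dT2 dTN2 dk2] := signature_dim sig2.
have rE : r = \rank (C - B *m invmx A *m B).
  have /eqP := isometric_dim_displacements iso1.
  rewrite (isometric_dim_displacements iso2) /displacements => dd.
  (* For [m = 0] both [r] and the rank are zero. For [m > 0] the map [a] is nonzero in both
     realizations, so both displacement spaces have dimension one more than [T + aT]. *)
  have [m0|m0] := posnP m.
    have := rank_leq_row (C - B *m invmx A *m B).
    have im0 : imageN rho2 = 0%VS.
      apply/eqP; rewrite -subv0; apply/subvP => _ /imageNP[u ->].
      have T0 : (rT rho2 <= 0)%VS by rewrite subv0 -dimv_eq0 dT2 m0.
      have -> : u = 0.
        by apply/subvs_inj/eqP; rewrite linear0 -memv0 (subvP T0)// subvsP.
      by rewrite !linear0 mem0v.
    by move: dTN2; rewrite im0 addv0 dT2; lia.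
  have a2 : ra rho2 != 0.
    apply: contraTneq m0 => a2z; rewrite -leqNgt leqn0 -dT2 -[X in _ == X]dk2.
    have -> : lker (ra rho2) = fullv.
      by apply/vspaceP => z; rewrite memvf memv_ker a2z zero_lfunE eqxx.
    by rewrite dimvf.
  (* The value of [C] at the vector of ones, nonzero as [m > 0], is minus the square of an image
     under [Y], and it is positive. *)
  have a1 : ra rho != 0.
    apply/eqP => a1z; have [_ /(_ (const_mx 1))] := posC.
    have -> : const_mx 1 != 0 :> 'rV[R]_m.
      apply/eqP => /matrixP/(_ 0 (Ordinal m0))/eqP.
      by rewrite !mxE oner_eq0.
    move=> /(_ isT); have [_ _ ->] := qpolymx_coef quad (const_mx 1).
    have -> : Y (const_mx 1) = 0 by rewrite YE yE a1z zero_lfunE !linear0.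
    by rewrite sym0l oppr0 ltxx.
  move: dd; rewrite (negbTE a2) (negbTE a1) !dim_displacement_space eqSS.
  by rewrite dTN2 rk eqn_add2l => /eqP.
split=> //.
- exact: (qpolymx_posdef symA symB symC0 XN YN XY_inj quad).
- have : (\dim (rT rho + imageN rho) <= n - 2)%N.
    rewrite -(dim_Nspace (rv0_null rho) (rv0_rv1 rho)).
    by apply: dimvS; rewrite subv_add rT_sub imageN_sub.
  by rewrite rk -rE; have := realization_ge2 rho; lia.
- exact: (schur_nneg symA symB symC0 XN YN XY_sym XY_inj quad).
Qed.

(** * Construction of a realization *)

Section LightConeCoordinates.
Variables (R : realType) (p : nat).
Local Notation V := 'rV[R]_(1 + (1 + p)).

(** Light-cone coordinates: the first two belong to the null vectors that become [v0] and [v1], the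
    last one to [N]. *)
Definition lc (a b : R) (w : 'rV[R]_p) : V := row_mx a%:M (row_mx b%:M w).
Definition lc0 (v : V) : R := lsubmx v 0 0.
Definition lc1 (v : V) : R := lsubmx (rsubmx v) 0 0.
Definition lc2 (v : V) : 'rV[R]_p := rsubmx (rsubmx v).

Lemma lcK v : lc (lc0 v) (lc1 v) (lc2 v) = v.
Proof. by rewrite /lc /lc0 /lc1 /lc2 -!mx11_scalar !hsubmxK. Qed.

Lemma lc00 w : lc 0 0 w = row_mx 0 (row_mx 0 w).
Proof. by rewrite /lc raddf0. Qed.

Lemma lc0E a b w : lc0 (lc a b w) = a.
Proof. by rewrite /lc0 /lc row_mxKl mxE eqxx. Qed.

Lemma lc1E a b w : lc1 (lc a b w) = b.
Proof. by rewrite /lc1 /lc row_mxKr row_mxKl mxE eqxx. Qed.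

Lemma lc2E a b w : lc2 (lc a b w) = w.
Proof. by rewrite /lc2 /lc !row_mxKr. Qed.

Definition lc_form (u v : V) : R :=
  lc0 u * lc1 v + lc1 u * lc0 v - (lc2 u *m (lc2 v)^T) 0 0.

Lemma lc_formC u v : lc_form u v = lc_form v u.
Proof.
rewrite /lc_form; congr (_ - _); first by rewrite addrC; congr (_ + _); rewrite mulrC.
by rewrite -[lc2 u *m _]trmxK trmx_mul trmxK mxE.
Qed.

Lemma lc_form_linear u : linear_for *%R (lc_form u).
Proof.
move=> a x y; rewrite /lc_form.
have -> : lc2 (a *: x + y) = a *: lc2 x + lc2 y by rewrite /lc2 !linearP.
have -> : (lc2 u *m (a *: lc2 x + lc2 y)^T) 0 0 =
    a * (lc2 u *m (lc2 x)^T) 0 0 + (lc2 u *m (lc2 y)^T) 0 0.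
  by rewrite linearP /= mulmxDr -scalemxAr !mxE.
have -> : lc0 (a *: x + y) = a * lc0 x + lc0 y by rewrite /lc0 !mxE.
have -> : lc1 (a *: x + y) = a * lc1 x + lc1 y by rewrite /lc1 !mxE.
by ring.
Qed.

Lemma lc_form_bilinear :
  bilinear_for (GRing.Scale.Law.clone _ _ ( *%R ) _)
    (GRing.Scale.Law.clone _ _ (@idfun R \; *%R ) _) lc_form.
Proof.
split=> [u'|u] a x y /=; last exact: lc_form_linear.
by rewrite lc_formC lc_form_linear [lc_form u' x]lc_formC [lc_form u' y]lc_formC.
Qed.

HB.instance Definition _ := bilinear_isBilinear.Build R V V R
  (GRing.Scale.Law.clone _ _ ( *%R ) _)
  (GRing.Scale.Law.clone _ _ (@idfun R \; *%R ) _) lc_form lc_form_bilinear.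

Lemma lc_form_hermitian u v :
  lc_form u v = (-1) ^+ false * idfun (lc_form v u).
Proof. by rewrite expr0 mul1r /= lc_formC. Qed.

HB.instance Definition _ := @isHermitianSesquilinear.Build R V false idfun
  lc_form lc_form_hermitian.

Definition lc_sym : {symmetric V} := lc_form.

Lemma lc_symE a b w a' b' w' :
  lc_sym (lc a b w) (lc a' b' w') = a * b' + b * a' - (w *m w'^T) 0 0.
Proof. by rewrite /lc_sym /= /lc_form !lc0E !lc1E !lc2E. Qed.

Lemma lc_lorentzian : lorentzian lc_sym.
Proof.
(* An orthonormal basis: the sum and the difference of [v0] and half of [v1] are orthogonal with
   squares 1 and -1, and the unit vectors of [N] complete them. *)
pose P : 'M[R]_(1 + (1 + p)) := col_mx (lc 1 2^-1 0)
  (col_mx (lc 1 (- 2^-1) 0) (row_mx 0 (row_mx 0 1%:M))).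
have P0 (i : 'I_1) : row (lshift _ i) P = lc 1 2^-1 0.
  by rewrite rowKu row_id.
have P1 (i : 'I_1) : row (rshift 1 (lshift _ i)) P = lc 1 (- 2^-1) 0.
  by rewrite rowKd rowKu row_id.
have P2 i : row (rshift 1 (rshift 1 i)) P = lc 0 0 'e_i.
  by rewrite rowKd rowKd !row_row_mx !row0 row1 lc00.
have gram i j : lc_sym (row i P) (row j P) =
    if i == j then (if (i == 0 :> nat)%N then 1 else -1) else 0.
  have ee (a b : 'I_p) : (('e_a : 'rV[R]_p) *m ('e_b : 'rV[R]_p)^T) 0 0 = (a == b)%:R.
    by rewrite trmx_delta mul_delta_mx_cond mulmxnE mxE !eqxx; case: (a == b).
  case: (split_ordP i) => [{}i ->|i1 ->]; last case: (split_ordP i1) => [{}i1 ->|{}i ->];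
  (case: (split_ordP j) => [{}j ->|j1 ->]; last case: (split_ordP j1) => [{}j1 ->|{}j ->]);
  rewrite ?P0 ?P1 ?P2 lc_symE ?trmx0 ?mulmx0 ?mul0mx ?ee ?mxE -!val_eqE /= ?ord1 /=; try lra.
  rewrite !eqn_add2l -[(i == j :> nat)%N]/(i == j).
  by case: (i == j); rewrite /= ?mulr1n ?mulr0n; lra.
(* The Gram matrix of the rows is diagonal with nonzero entries, so pairing a linear relation with
   row [j] kills its coefficient [j]. *)
exists P => //; rewrite -row_free_unit -kermx_eq0.
apply/eqP/row_matrixP => i; rewrite row0; set z := row i _.
have zP : z *m P = 0 by apply/sub_kermxP; exact: row_sub.
apply/rowP => j; rewrite [RHS]mxE.
have := sym0l lc_sym (row j P); rewrite -zP mulmx_sum_row sym_suml.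
rewrite (bigD1 j)//= big1 => [|a aj]; last first.
  by rewrite symZl gram (negbTE aj) mulr0.
rewrite addr0 symZl gram eqxx; case: ifP => _; first by rewrite mulr1.
by rewrite mulrN1 => /eqP; rewrite oppr_eq0 => /eqP.
Qed.

End LightConeCoordinates.

(** * The light cone as a dual cone *)

Section DualCones.
Variables (R : realType) (n : nat) (l : {symmetric 'rV[R]_n}).
Local Notation V := 'rV[R]_n.

Lemma form_continuous u : continuous (l u : V -> R).
Proof.
have [K K0 lK] := form_bounded l u => x.
apply/(@cvgrPdist_lt _ _ _ (nbhs (x : 'rV[R]_n))) => e e0.
have eK : 0 < e / K by rewrite divr_gt0.
apply: filterS (nbhsx_ballx x _ eK) => y; rewrite -ball_normE /= => xy.
by rewrite -symNr -symDr (le_lt_trans (lK _))// mulrC -ltr_pdivlMr.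
Qed.

(** As an intersection of closed half-spaces, the cone is closed and convex for any [S], without a
    Cauchy-Schwarz argument. *)
Definition dual_cone (S : set V) : set V := [set v | forall u, S u -> 0 <= l u v].

Lemma dual_cone_closed_convex S : closed_convex_cone (dual_cone S).
Proof.
split.
- have -> : dual_cone S = \bigcap_(u in S) (l u @^-1` [set x | 0 <= x]) by [].
  apply: closed_bigI => u _; apply: preimage_closed; last exact: closed_ge.
  by move=> v _; exact: form_continuous.
- by move=> u _; rewrite sym0r.
- by move=> v w Kv Kw u Su; rewrite symDr addr_ge0 ?Kv ?Kw.
- by move=> t v t0 Kv u Su; rewrite symZr mulr_ge0// Kv.
Qed.

(** The functional [l u] supports the cone at [v], and arbitrarily short steps from [v] against [d]
    leave the cone. *)
Lemma dual_cone_boundary S v u d : dual_cone S v -> S u -> l u v = 0 ->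
  0 < l u d -> boundary (dual_cone S) v.
Proof.
move=> Kv Su uv ud; split; first exact: subset_closure.
move=> /nbhs_ballP[e /= e0 eK].
pose t := e / (`|d| + 1) / 2.
have N0 : 0 < `|d| + 1 by rewrite ltr_wpDl.
have t0 : 0 < t by rewrite !divr_gt0.
have : dual_cone S (v - t *: d).
  apply: eK; rewrite -ball_normE /= opprB addrCA subrr addr0 normrZ gtr0_norm//.
  rewrite /t mulrAC ltr_pdivrMr// mulrAC ltr_pdivrMr// -mulrA ltr_pM2l//.
  by rewrite mulrC mulrDl mul1r; lra.
move=> /(_ _ Su); rewrite symDr symNr symZr uv sub0r oppr_ge0 leNgt => /negP.
by apply; rewrite mulr_gt0.
Qed.

End DualCones.

Section LightCone.
Variables (R : realType) (p : nat).
Local Notation V := 'rV[R]_(1 + (1 + p)).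
Local Notation l := (lc_sym R p).
Implicit Types w t : 'rV[R]_p.

Local Notation "w '*|' t" := ((w *m t^T) 0 0) (at level 40).

Lemma dotC w t : w *| t = t *| w.
Proof. by rewrite -[w *m _]trmxK trmx_mul trmxK mxE. Qed.

(* Up to scaling, these are the null vectors of the future light cone. *)
Definition null_rays : set V :=
  [set u | u = lc 1 0 0 \/ exists t, u = lc (2^-1 * (t *| t)) 1 (- t)].

Lemma dual_null_raysE a b w : dual_cone l null_rays (lc a b w) <->
  0 <= b /\ forall t, 0 <= a + w *| t + 2^-1 * b * (t *| t).
Proof.
have e0 : l (lc 1 0 0) (lc a b w) = b.
  by rewrite lc_symE mul0mx mxE; ring.
have et t : l (lc (2^-1 * (t *| t)) 1 (- t)) (lc a b w) =
    a + w *| t + 2^-1 * b * (t *| t).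
  rewrite lc_symE dotC linearN /= mulmxN [X in _ - X]mxE; ring.
split=> [K|[b0 K] u [->|[t ->]]]; rewrite ?e0 ?et//.
by split=> [|t]; [rewrite -e0; apply: K; left|rewrite -et; apply: K; right; exists t].
Qed.

Lemma dot_comb a w t : (w + a *: t) *| (w + a *: t) =
  w *| w + 2 * a * (w *| t) + a ^+ 2 * (t *| t).
Proof.
rewrite linearD linearZ /= mulmxDl !mulmxDr -!scalemxAr -!scalemxAl.
have -> (M N P Q : 'M[R]_1) : (M + a *: N + (P + a *: Q)) 0 0 =
    M 0 0 + a * N 0 0 + (P 0 0 + a * Q 0 0) by rewrite !mxE.
have Z (M : 'M[R]_1) : (a *: M) 0 0 = a * M 0 0 by rewrite mxE.
by rewrite !Z [t *| w]dotC; ring.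
Qed.

Lemma dotZr a w t : w *| (a *: t) = a * (w *| t).
Proof. by rewrite linearZ /= -scalemxAr mxE. Qed.

Lemma dot_ge0 w : 0 <= w *| w. Proof. exact: mulmx_tr_ge0. Qed.

(** The defining inequality is a quadratic polynomial in [t]. For [b > 0] it is used at the minimum
    [t = - b^-1 *: w]; for [b = 0] it is affine, and nonnegativity forces [w = 0]. *)
Lemma dual_null_rays_causal v : dual_cone l null_rays v -> 0 <= l v v.
Proof.
rewrite -(lcK v); move: (lc0 v) (lc1 v) (lc2 v) => a b w.
rewrite dual_null_raysE lc_symE => -[b0 H].
have [bz|bn] := eqVneq b 0.
  have [wz|wn] := eqVneq (w *| w) 0; first by rewrite bz wz; lra.
  (* With [b = 0] and [w] nonzero, the inequality at this [t] would read that -1 is nonnegative. *)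
  have := H (- (a + 1) / (w *| w) *: w); rewrite !dotZr bz -!mulrA mulVf//.
  by lra.
have bp : 0 < b by rewrite lt_def bn.
have := H (- b^-1 *: w); rewrite dotZr [X in _ + X]mulrC.
have -> : (- b^-1 *: w) *| (- b^-1 *: w) = b^-1 ^+ 2 * (w *| w).
  by rewrite dotZr dotC dotZr; ring.
have -> : b^-1 ^+ 2 * (w *| w) * (2^-1 * b) = 2^-1 * b^-1 * (w *| w) by field.
rewrite -(pmulr_rge0 _ bp) => h.
have -> : a * b + b * a - w *| w =
    2 * (b * (a + - b^-1 * (w *| w) + 2^-1 / b * (w *| w))) by field.
by rewrite mulr_ge0.
Qed.

(** For [b > 0], [2 b] times the quantity to be bounded is [2 a b - |w|^2] plus the square of the
    norm of [w + b *: t]. For [b = 0], causality forces [w = 0]. *)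
Lemma causal_dual_null_rays a b w : 0 <= l (lc a b w) (lc a b w) ->
  0 < b \/ b = 0 /\ 0 <= a -> dual_cone l null_rays (lc a b w).
Proof.
rewrite lc_symE dual_null_raysE => h [bp|[bz a0]].
  split=> [|t]; first exact: ltW.
  have := dot_ge0 (w + b *: t); rewrite dot_comb => h2.
  rewrite -(pmulr_rge0 _ bp) -(pmulr_rge0 _ (ltr0Sn R 1)); move: h h2.
  by move: (w *| w) (w *| t) (t *| t) => x y z; nra.
rewrite bz lexx; split=> // t.
move: h; rewrite bz mulr0 mul0r addr0 sub0r oppr_ge0 => h.
have -> : w = 0 by apply: mulmx_tr_eq0; apply/eqP; rewrite eq_le h dot_ge0.
by rewrite mul0mx mxE mulr0 mul0r !addr0.
Qed.

(** The second cone is the negative of the first. A causal vector is assigned to one of them by the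
    sign of [b], or by that of [a] when [b = 0]. *)
Lemma causal_cone_null_rays : causal_cone l (dual_cone l null_rays).
Proof.
split; first exact: dual_cone_closed_convex.
exists (dual_cone l [set u | null_rays (- u)]); first exact: dual_cone_closed_convex.
have E v : dual_cone l [set u | null_rays (- u)] v <-> dual_cone l null_rays (- v).
  split=> K u Su; first by rewrite symNr -symNl K//= opprK.
  by have := K (- u) Su; rewrite symNr symNl opprK.
apply/seteqP; split=> v /=.
  move=> [/dual_null_rays_causal//|/E/dual_null_rays_causal].
  by rewrite symNl symNr opprK.
rewrite -(lcK v); move: (lc0 v) (lc1 v) (lc2 v) => a b w vv.
have NE : - lc a b w = lc (- a) (- b) (- w).
  by rewrite /lc !opp_row_mx !raddfN.
have Nvv : 0 <= l (lc (- a) (- b) (- w)) (lc (- a) (- b) (- w)).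
  by rewrite -NE symNl symNr opprK.
case: (ltgtP b 0) => [bn|bp|bz].
- right; apply/E; rewrite NE; apply: causal_dual_null_rays => //.
  by left; rewrite oppr_gt0.
- by left; apply: causal_dual_null_rays => //; left.
case: (lerP 0 a) => [a0|a0].
  by left; apply: causal_dual_null_rays => //; right.
right; apply/E; rewrite NE; apply: causal_dual_null_rays => //.
by right; rewrite bz oppr0 oppr_ge0 ltW.
Qed.

Lemma lc_boundary0 : boundary (dual_cone l null_rays) (lc 1 0 0).
Proof.
apply: (@dual_cone_boundary _ _ _ _ _ (lc 1 0 0) (lc 0 1 0)).
- apply: causal_dual_null_rays; last by right; rewrite ler01.
  by rewrite lc_symE mul0mx mxE; lra.
- by left.
- by rewrite lc_symE mul0mx mxE; lra.
- by rewrite lc_symE mul0mx mxE; lra.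
Qed.

Lemma lc_boundary1 : boundary (dual_cone l null_rays) (lc 0 1 0).
Proof.
apply: (@dual_cone_boundary _ _ _ _ _ (lc 0 1 0) (lc 1 0 0)).
- apply: causal_dual_null_rays; last by left.
  by rewrite lc_symE mul0mx mxE; lra.
- by right; exists 0; rewrite mul0mx mxE mulr0 oppr0.
- by rewrite lc_symE mul0mx mxE; lra.
- by rewrite lc_symE mul0mx mxE; lra.
Qed.

Lemma mem_lc_Nspace w : lc 0 0 w \in Nspace l (lc 1 0 0) (lc 0 1 0).
Proof.
rewrite memv_cap !mem_orthov1 !lc_symE !trmx0 !mulmx0 !mul0r [X in _ - X]mxE.
by rewrite !addr0 subr0 eqxx.
Qed.

End LightCone.

(** * The identity as an isometry *)

Lemma Ck_cst (R : realType) (n k : nat) (U : set 'rV[R]_n) (c : 'rV[R]_n) :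
  Ck k U (cst c).
Proof.
elim: k c => [c x _|k IH c]; first exact: cst_continuous.
split=> [x _|v]; first exact: differentiable_cst.
by rewrite (_ : 'D_v (cst c) = cst 0)//; apply/funext => x; rewrite derive_cst.
Qed.

Lemma smooth_id (R : realType) (n : nat) (U : set 'rV[R]_n) : smooth U id.
Proof.
move=> [|k]; first by move=> x _; exact: cvg_id.
split=> [x _|v]; first by [].
rewrite (_ : 'D_v id = cst v); first exact: Ck_cst.
by apply/funext => x; rewrite derive_id.
Qed.

Lemma isometric_refl (R : realType) (n : nat) (M : realization R n) : isometric M M.
Proof.
exists id; split; first by split=> [s|s t _ _|s Ms] //; exists s.
move=> v; exists setT, id; split=> //.
- by split=> //; exact: openT.
- exact: smooth_id.
move=> u _; have dE w : 'd id u w = w by rewrite -deriveE// derive_id.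
split=> [w w'|]; first by rewrite !dE.
by apply/seteqP; split=> [_ [w Kw <-]|w Kw]; [rewrite dE|exists w].
Qed.

(** * The realization attached to two factor matrices *)

Section Construction.
Variables (R : realType) (m p : nat) (F H : 'M[R]_(m, p)).
Local Notation n := (1 + (1 + p))%N.
Local Notation V := 'rV[R]_n.
Local Notation l := (lc_sym R p).
Local Notation v0 := (lc 1 0 (0 : 'rV[R]_p)).
Local Notation v1 := (lc 0 1 (0 : 'rV[R]_p)).
Local Notation N := (Nspace l v0 v1).
Hypothesis FH_inj : forall s (z : 'rV[R]_m), z *m (F + s *: H) = 0 -> z = 0.
Hypothesis FH_sym : F *m H^T = H *m F^T.

Definition embed (G : 'M[R]_(m, p)) : 'M[R]_(m, n) := row_mx 0 (row_mx 0 G).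

Lemma mul_embed (G : 'M[R]_(m, p)) (z : 'rV[R]_m) : z *m embed G = lc 0 0 (z *m G).
Proof. by rewrite lc00 /embed !mul_mx_row !mulmx0. Qed.

Lemma embed_N (G : 'M[R]_(m, p)) (z : 'rV[R]_m) : z *m embed G \in N.
Proof. by rewrite mul_embed mem_lc_Nspace. Qed.

Lemma form_embed (G G' : 'M[R]_(m, p)) (z w : 'rV[R]_m) :
  l (z *m embed G) (w *m embed G') = - (z *m (G *m G'^T) *m w^T) 0 0.
Proof. by rewrite !mul_embed lc_symE trmx_mul !mulmxA; ring. Qed.

(** The rows of [X] span [T] and are independent by [FH_inj] at [s = 0]; the right inverse [Xi]
    reads off coordinates in this basis. *)
Let X := embed F.
Let Xi : 'M[R]_(n, m) := pinvmx X.
Let T : {vspace V} := limg (linfun (mulmxr X : 'rV[R]_m -> V)).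

Let XXi : X *m Xi = 1%:M.
Proof.
apply: mulmxVp; rewrite -kermx_eq0; apply/eqP/row_matrixP => i; rewrite row0.
set z := row i _; have : z *m X = 0 by apply/sub_kermxP; exact: row_sub.
rewrite mul_embed => /(congr1 (@lc2 R p)); rewrite lc2E => zF.
apply: (@FH_inj 0); rewrite scale0r addr0 zF.
by rewrite /lc2 !linear0.
Qed.

Let TP (v : V) : reflect (exists z, v = z *m X) (v \in T).
Proof.
apply: (iffP memv_imgP) => [[z _ ->]|[z ->]]; exists z; rewrite ?memvf ?lfunE//.
Qed.

Let TN : (T <= N)%VS.
Proof. by apply/subvP => v /TP[z ->]; exact: embed_N. Qed.

(** The linear map that takes each row of [X] to the row of [embed G] with the same index. *)
Definition rowspace_map (G : 'M[R]_(m, p)) : 'Hom(subvs_of T, subvs_of N) :=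
  (linfun (vsproj N) \o
    (linfun (mulmxr (Xi *m embed G)) \o linfun vsval))%VF.

Lemma rowspace_mapE (G : 'M[R]_(m, p)) (x : subvs_of T) (z : 'rV[R]_m) :
  vsval x = z *m X -> vsval (rowspace_map G x) = z *m embed G.
Proof.
move=> xz; rewrite !comp_lfunE !lfunE /= xz mulmxA -(mulmxA z) XXi mulmx1.
by rewrite vsprojK ?embed_N.
Qed.

Let subT (x : subvs_of T) : exists z, vsval x = z *m X.
Proof. exact/TP/subvsP. Qed.

Definition integer_points : set V :=
  [set map_mx intr z *m X | z in [set: 'rV[int]_m]].

(** Close points have coordinates less than 1 apart, since [Xi] is bounded, and integers that close
    are equal. Rounding coordinates down leaves a remainder in the image of the unit cube, which is
    compact. *)
Lemma integer_points_lattice : lattice T integer_points.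
Proof.
split.
- by move=> _ [z _ <-]; apply/TP; eexists.
- split; first by exists 0; rewrite // map_mx0 mul0mx.
  by move=> _ _ [z _ <-] [w _ <-]; exists (z - w); rewrite // map_mxB mulmxBl.
- move=> _ [z _ <-]; split; first by rewrite inE; exists z.
  have [K K0 XiK] := @linear_rV_bounded R n 'rV[R]_m (mulmxr Xi).
  have K1 : 0 < K^-1 by rewrite invr_gt0.
  exists (ball (map_mx intr z *m X) K^-1); first exact: nbhsx_ballx.
  apply/seteqP; split=> [v [+ [w _ vE]]|v ->]; last first.
    by split; [exact: ballxx|exists z].
  rewrite -{}vE -ball_normE /= -mulmxBl -map_mxB => zw; congr (map_mx _ _ *m _).
  apply/rowP => i; apply/eqP; rewrite eq_sym -subr_eq0.
  have : `|z 0 i - w 0 i| < 1.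
    rewrite -(ltr_int R) intr_norm.
    have := coord_norm (map_mx (intr : int -> R) (z - w)) 0 i.
    have -> : map_mx (intr : int -> R) (z - w) 0 i = (z 0 i - w 0 i)%:~R.
      by rewrite !mxE.
    move=> h; apply: le_lt_trans h _.
    have := XiK (map_mx intr (z - w) *m X); rewrite /= -mulmxA XXi mulmx1.
    by move=> h; apply: le_lt_trans h _; rewrite mulrC -ltr_pdivlMr// div1r.
  lia.
exists (mulmxr X @` [set z : 'rV[R]_m | forall i, `[0, 1]%classic (z 0 i)]).
split.
- apply: continuous_compact.
    by apply: continuous_subspaceT; exact: linear_rV_continuous.
  by apply: (@rV_compact _ _ (fun=> `[(0 : R), (1 : R)]%classic)) => _;
    exact: segment_compact.
- by move=> _ [z _ <-]; apply/TP; exists z.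
move=> _ /TP[z ->]; exists (map_mx intr (map_mx Num.floor z) *m X).
  by exists (map_mx Num.floor z).
exists (z - map_mx intr (map_mx Num.floor z)); last by rewrite /= mulmxBl.
move=> i; rewrite /= in_itv /= !mxE subr_ge0 floor_le /= lerBlDl.
by have := floorD1_gt (z 0 i); rewrite intrD => /ltW.
Qed.

Lemma rowspace_map_sym (x y : subvs_of T) :
  l (vsval (rowspace_map H x)) (vsval y) = l (vsval x) (vsval (rowspace_map H y)).
Proof.
have [z xz] := subT x; have [w yw] := subT y.
by rewrite (rowspace_mapE H xz) (rowspace_mapE H yw) xz yw !form_embed FH_sym.
Qed.

Lemma rowspace_map_inj (s : R) (x : subvs_of T) :
  vsval x + s *: vsval (rowspace_map H x) = 0 -> x = 0.
Proof.
have [z xz] := subT x; rewrite (rowspace_mapE H xz) xz => e.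
apply/subvs_inj; rewrite linear0 xz (@FH_inj s z) ?mul0mx//.
move: e => /(congr1 (@lc2 R p)).
have -> : z *m X + s *: (z *m embed H) = z *m embed (F + s *: H).
  rewrite scalemxAr -mulmxDr; congr (_ *m _).
  by rewrite /X /embed !scale_row_mx !add_row_mx !scaler0 !addr0.
by rewrite mul_embed lc2E => ->; rewrite /lc2 !linear0.
Qed.

Lemma lc_v0v1 : l v0 v1 = 1.
Proof. by rewrite lc_symE mul0mx mxE; ring. Qed.

Definition gram_realization : realization R n :=
  @Realization R n l (dual_cone l (@null_rays R p)) v0 v1 T (rowspace_map H)
    integer_points isT (lc_lorentzian R p) (causal_cone_null_rays R p)
    (lc_boundary0 R p) (lc_boundary1 R p) lc_v0v1 TN integer_points_lattice
    rowspace_map_sym rowspace_map_inj.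

Local Notation B := (F *m H^T).
Local Notation Q := (qpolymx (F *m F^T) B (H *m H^T)).

Lemma gram_qpolymx s : Q s = (F + s *: H) *m (F + s *: H)^T.
Proof.
rewrite /qpolymx linearD linearZ /= mulmxDl !mulmxDr -!scalemxAr -!scalemxAl.
rewrite -FH_sym scalerA -expr2 !addrA; congr (_ + _).
by rewrite -!addrA; congr (_ + _); rewrite -scalerDl; congr (_ *: _); ring.
Qed.

Let iota : 'Hom('rV[R]_m, subvs_of T) :=
  (linfun (vsproj T) \o linfun (mulmxr X : 'rV[R]_m -> V))%VF.

Let iotaE z : vsval (iota z) = z *m X.
Proof. by rewrite comp_lfunE !lfunE /= vsprojK//; apply/TP; exists z. Qed.

Lemma gram_characteristic : characteristic_polynomial gram_realization Q.
Proof.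
exists gram_realization, iota, (F *m F^T), B, (H *m H^T), 1, 0; split.
- exact: isometric_refl.
- split.
    exists (fun x => vsval x *m Xi) => [z|x].
      by rewrite iotaE -mulmxA XXi mulmx1.
    have [z xz] := subT x; apply/subvs_inj.
    by rewrite iotaE xz -(mulmxA z) XXi mulmx1.
  apply/seteqP; split=> _ [z _ <-]; exists z => //; exact: iotaE.
- by split; apply/symmetricmxP; rewrite trmx_mul ?trmxK.
- move=> s z; rewrite /qform /= (rowspace_mapE H (iotaE z)) iotaE.
  have -> : z *m X + s *: (z *m embed H) = z *m embed (F + s *: H).
    rewrite scalemxAr -mulmxDr; congr (_ *m _).
    by rewrite /X /embed !scale_row_mx !add_row_mx !scaler0 !addr0.
  by rewrite form_embed opprK gram_qpolymx.
- by split=> // s; rewrite mul1r addr0.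
Qed.

Let A_posdef : posdefmx (F *m F^T).
Proof.
split; first by apply/symmetricmxP; rewrite trmx_mul trmxK.
move=> z z0; rewrite qform_gram lt_def mulmx_tr_ge0 andbT.
apply: contra z0 => /eqP/mulmx_tr_eq0 zF; apply/eqP/(@FH_inj 0).
by rewrite scale0r addr0.
Qed.

(** With [A = F *m F^T], the matrix [E = B *m invmx A] satisfies [E *m A = B], so [E] represents
    [a'] in the basis of [T]. The remainder [W] represents [a''], and its Gram matrix is the Schur
    complement. *)
Lemma gram_signature : (forall z : 'rV[R]_m, z *m H = 0 -> z = 0) ->
  realization_signature gram_realization
    (n, m, \rank (H *m H^T - B *m invmx (F *m F^T) *m B), 0%N).
Proof.
move=> H_inj; pose A := F *m F^T; have Au : A \in unitmx by exact: posdef_unit.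
pose E := B *m invmx A; pose W := H - E *m F.
pose a' : 'Hom(subvs_of T, subvs_of T) := (linfun (vsproj T) \o
  (linfun (mulmxr (Xi *m (E *m X)) : V -> V) \o linfun vsval))%VF.
have a'E (x : subvs_of T) z : vsval x = z *m X -> vsval (a' x) = z *m (E *m X).
  move=> xz; rewrite !comp_lfunE !lfunE /= xz -[z *m X *m _]mulmxA.
  rewrite [X *m _]mulmxA XXi mul1mx vsprojK//.
  by apply/TP; exists (z *m E); rewrite mulmxA.
have EX : E *m X = embed (E *m F) by rewrite /X /embed !mul_mx_row !mulmx0.
exists a', (rowspace_map W); split.
- move=> x; have [z xz] := subT x.
  rewrite /= (rowspace_mapE H xz) (rowspace_mapE W xz) (a'E x z xz) EX -mulmxDr.
  congr (_ *m _); rewrite /embed !add_row_mx !addr0; congr (row_mx _ (row_mx _ _)).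
  by rewrite addrC subrK.
- move=> x y; have [z xz] := subT x; have [w yw] := subT y.
  rewrite /= (rowspace_mapE H xz) (a'E x z xz) EX yw !form_embed.
  congr (- (_ *m _ *m _) 0 0).
  by rewrite -mulmxA -/A /E -mulmxA mulVmx// mulmx1.
congr (_, _, _, _).
- by rewrite /= dim_limg_mulmxr; apply/esym/eqP/row_freeP; exists Xi.
- have limW : (linfun vsval @: limg (rowspace_map W))%VS =
      limg (linfun (mulmxr (embed W) : 'rV[R]_m -> V)).
    apply/eqP; rewrite eqEsubv; apply/andP; split; apply/subvP => v.
      move=> /memv_imgP[_ /memv_imgP[x _ ->] ->]; have [z xz] := subT x.
      rewrite lfunE /= (rowspace_mapE W xz).
      by apply/memv_imgP; exists z; rewrite ?memvf ?lfunE.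
    move=> /memv_imgP[z _ ->]; rewrite lfunE /= -(rowspace_mapE W (iotaE z)).
    apply/memv_imgP; exists (rowspace_map W (iota z)); last exact/esym/lfunE.
    by rewrite memv_img ?memvf.
  have <- : \dim (linfun vsval @: limg (rowspace_map W)) = \dim (limg (rowspace_map W)).
    apply: limg_dim_eq; apply/eqP; rewrite -subv0; apply/subvP => x.
    rewrite memv_cap memv_ker lfunE /= memv0 => /andP[_ /eqP x0].
    by apply/eqP/subvs_inj; rewrite x0 linear0.
  rewrite limW dim_limg_mulmxr /embed !rank_row_0mx -[RHS]rank_gram.
  (* Two cross terms with sign minus and one square with sign plus are all equal to
     [B *m invmx A *m B], so one of them survives. *)
  suff -> : W *m W^T = H *m H^T - B *m invmx A *m B by [].
  rewrite /W linearB /= mulmxBl !mulmxBr trmx_mul /E trmx_mul trmx_inv.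
  have AT : A^T = A by rewrite /A trmx_mul trmxK.
  have BT : B^T = B by rewrite trmx_mul trmxK -FH_sym.
  rewrite AT BT.
  have -> : H *m (F^T *m (invmx A *m B)) = B *m invmx A *m B.
    by rewrite !mulmxA -FH_sym.
  have -> : B *m invmx A *m F *m H^T = B *m invmx A *m B by rewrite -!mulmxA.
  have -> : B *m invmx A *m F *m (F^T *m (invmx A *m B)) = B *m invmx A *m B.
    by rewrite -[LHS]mulmxA; congr (_ *m _); rewrite [LHS]mulmxA -/A mulKVmx.
  by rewrite subrr subr0.
apply/esym/eqP; rewrite dimv_eq0 -subv0; apply/subvP => x.
rewrite memv_ker memv0 => /eqP /= x0; have [z xz] := subT x.
have := rowspace_mapE H xz; rewrite x0 linear0 mul_embed.
move=> /(congr1 (@lc2 R p)); rewrite lc2E {1}/lc2 !linear0 => /esym/H_inj z0.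
by apply/eqP/subvs_inj; rewrite xz z0 mul0mx linear0.
Qed.

End Construction.

Lemma char_poly_sufficient (R : realType) (m n r : nat) (A B C : 'M[R]_m)
    (posC : posdefmx C) (symB : B \is symmetricmx) :
  (forall s, posdefmx (qpolymx A B C s)) -> (m + r + 2 <= n)%N ->
  nnegdefmx (C - B *m invmx A *m B) -> r = \rank (C - B *m invmx A *m B) ->
  exists M : unipotent_manifold R n,
    signature M (n, m, r, 0%N) /\ characteristic_polynomial M (qpolymx A B C).
Proof.
move=> posQ mrn nD rD.
have [k nE] : exists k, n = (1 + (1 + (m + (r + k))))%N.
  by exists (n - (m + r + 2))%N; lia.
subst n.
have posA : posdefmx A.
  by have := posQ 0; rewrite /qpolymx mulr0 expr0n /= !scale0r !addr0.
have [P Pu PA] := posdef_factor posA.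
have [S SD] := nnegdef_factor_rank nD rD.
(* The first block of [H] is forced by [F *m H^T = B]; its contribution to [H *m H^T] is
   [B *m invmx A *m B], and [S] supplies the rest of [C]. *)
pose F : 'M[R]_(m, m + (r + k)) := row_mx P 0.
pose H : 'M[R]_(m, m + (r + k)) := row_mx (B *m invmx P^T) (row_mx S 0).
have BT := symmetricmxP _ symB.
have FF : F *m F^T = A by rewrite tr_row_mx mul_row_col trmx0 mulmx0 addr0 -PA.
have FH : F *m H^T = B.
  rewrite tr_row_mx mul_row_col mul0mx addr0 trmx_mul trmx_inv trmxK BT.
  by rewrite mulmxA mulmxV// mul1mx.
have HH : H *m H^T = C.
  rewrite tr_row_mx mul_row_col tr_row_mx mul_row_col trmx0 mulmx0 addr0 -SD.
  rewrite trmx_mul trmx_inv trmxK BT PA.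
  have -> : B *m invmx P^T *m (invmx P *m B) = B *m invmx (P *m P^T) *m B.
    by rewrite invmx_gram// !mulmxA.
  by rewrite addrC subrK.
have FH_sym : F *m H^T = H *m F^T.
  by rewrite FH -[RHS]trmxK trmx_mul trmxK FH BT.
have QE s : (F + s *: H) *m (F + s *: H)^T = qpolymx A B C s.
  by rewrite -(gram_qpolymx FH_sym) FF FH HH.
have FH_inj s (z : 'rV[R]_m) : z *m (F + s *: H) = 0 -> z = 0.
  move=> z0; apply/eqP; apply: contraT => /((posQ s).2 z).
  by rewrite -QE qform_gram z0 mul0mx mxE ltxx.
have H_inj (z : 'rV[R]_m) : z *m H = 0 -> z = 0.
  move=> z0; apply/eqP; apply: contraT => /(posC.2 z).
  by rewrite -HH qform_gram z0 mul0mx mxE ltxx.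
exists (gram_realization FH_inj FH_sym); split.
  exists (gram_realization FH_inj FH_sym); first exact: isometric_refl.
  by have := gram_signature FH_inj FH_sym H_inj; rewrite FF FH HH -rD.
by have := gram_characteristic FH_inj FH_sym; rewrite FF FH HH.
Qed.

(** Completing the square in [A] writes [Q s] as a Gram matrix plus [s ^+ 2] times the Schur
    complement. The latter is positive for [s != 0], and at [s = 0] the polynomial is [A] itself. *)
Lemma schur_qpolymx_posdef (R : realType) (m : nat) (A B C : 'M[R]_m) :
  B \is symmetricmx -> posdefmx A -> posdefmx (C - B *m invmx A *m B) ->
  forall s, posdefmx (qpolymx A B C s).
Proof.
move=> symB posA posD s; have BT := symmetricmxP _ symB.
have AT := symmetricmxP _ posA.1; have Au := posdef_unit posA.
have [P Pu PA] := posdef_factor posA.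
have [->|s0] := eqVneq s 0.
  by rewrite /qpolymx mulr0 expr0n /= !scale0r !addr0.
pose D := C - B *m invmx A *m B.
have QE : qpolymx A B C s =
    ((A + s *: B) *m invmx P^T) *m ((A + s *: B) *m invmx P^T)^T + s ^+ 2 *: D.
  rewrite trmx_mul trmx_inv trmxK linearD linearZ /= AT BT.
  have -> : (A + s *: B) *m invmx P^T *m (invmx P *m (A + s *: B)) =
      (A + s *: B) *m invmx A *m (A + s *: B).
    by rewrite PA invmx_gram// !mulmxA.
  rewrite mulmxDl -scalemxAl mulmxV// mulmxDr !mulmxDl mul1mx -!scalemxAl mul1mx.
  rewrite -!scalemxAr mulmxKV// scalerA /D scalerBr -expr2 /qpolymx.
  by apply/matrixP => i j; rewrite !mxE; ring.
have DT := symmetricmxP _ posD.1.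
split=> [|z z0].
  by apply/symmetricmxP; rewrite QE linearD linearZ /= trmx_mul trmxK DT.
rewrite QE mulmxDr mulmxDl mxE -scalemxAr -scalemxAl [X in _ + X]mxE.
rewrite ltr_wpDl ?(gram_nneg _).2// mulr_gt0 ?exprn_even_gt0//.
exact: posD.2.
Qed.

Theorem theorem3 (R : realType) (m n r : nat) (A B C : 'M[R]_m)
    (symA : A \is symmetricmx) (symB : B \is symmetricmx)
    (symC : C \is symmetricmx) (posC : posdefmx C) :
  ((exists M : unipotent_manifold R n,
      signature M (n, m, r, 0%N) /\
      characteristic_polynomial M (qpolymx A B C))
   <->
   [/\ forall s : R, posdefmx (qpolymx A B C s),
       (m + r + 2 <= n)%N,
       nnegdefmx (C - B *m invmx A *m B) &
       r = \rank (C - B *m invmx A *m B)])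
  /\
  (m = r ->
   ((exists M : unipotent_manifold R n,
       signature M (n, m, r, 0%N) /\
       characteristic_polynomial M (qpolymx A B C))
    <->
    [/\ posdefmx A,
        (m + r + 2 <= n)%N,
        nnegdefmx (C - B *m invmx A *m B) &
        r = \rank (C - B *m invmx A *m B)])).
Proof.
have iff1 : (exists M : unipotent_manifold R n,
      signature M (n, m, r, 0%N) /\
      characteristic_polynomial M (qpolymx A B C))
   <->
   [/\ forall s : R, posdefmx (qpolymx A B C s),
       (m + r + 2 <= n)%N,
       nnegdefmx (C - B *m invmx A *m B) &
       r = \rank (C - B *m invmx A *m B)].
  split=> [[M [sM cM]]|[*]]; first exact: (char_poly_necessary symA symB posC sM cM).
  exact: char_poly_sufficient.
split=> // mr; split=> [/iff1[pQ *]|[pA mrn nD rD]].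
  split=> //; have := pQ 0.
  by rewrite /qpolymx mulr0 expr0n /= !scale0r !addr0.
(* For [m = r] the Schur complement is nonnegative of full rank, hence positive definite. *)
apply/iff1; split=> //; apply: schur_qpolymx_posdef => //.
apply: nneg_unit_posdef => //.
by rewrite -row_full_unit; apply/eqP; rewrite -rD mr.
Qed.
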